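(* Let $G$ be a group and let $L$ be a nilpotent normal subgroup of $G$ such that $G/L$ is a finitely generated hyper (abelian or finite) group. If $G$ is contranormal-free, then $G$ is hypercentral.
   Context: For a subgroup $H$ of a group $G$, $H^G=\langle H^x\mid x\in G\rangle$ denotes the normal closure of $H$ in $G$. The subgroup $H$ is contranormal in $G$ if $H^G=G$. A group $G$ is contranormal-free if it has no proper contranormal subgroups, i.e. the only subgroup $H\le G$ with $H^G=G$ is $H=G$. A group $Q$ is hyper (abelian or finite) if it has an ascending (possibly transfinite) series $1=Q_0\le Q_1\le\dots\le Q_\alpha\le Q_{\alpha+1}\le\dots\le Q_\gamma=Q$ of normal subgroups of $Q$, with $Q_\lambda=\bigcup_{\beta<\lambda}Q_\beta$ for limit ordinals $\lambda$, such that each factor $Q_{\alpha+1}/Q_\alpha$ is abelian or finite. A group is hypercentral if its transfinite upper central series reaches the whole group. *)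

(* Defs.v *)
From HB Require Import structures.
From mathcomp Require Import all_boot all_order.
From mathcomp Require Import boolp classical_sets functions cardinality.

Set Implicit Arguments.
Unset Strict Implicit.
Unset Printing Implicit Defensive.

Import Order.TTheory.

Local Open Scope quotient_scope.
Local Open Scope classical_set_scope.
Local Open Scope group_scope.

(* Groups are arbitrary (possibly infinite) [groupType]s and
   their subsets are classical [set]s.  Conjugation is [x ^ y = y^-1 * (x * y)]
   and [[~ x, y] = x^-1 * x ^ y]. *)

Section Subgroups.
Variable G : groupType.
Implicit Types (A H : set G).

Definition subgroup H : Prop :=
  [/\ H 1, forall x y, H x -> H y -> H (x * y) & forall x, H x -> H x^-1].

Definition generated A : set G := smallest subgroup A.

Definition finitely_generated : Prop :=
  exists A : set G, finite_set A /\ generated A = setT.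

Definition center : set G := [set x | forall y, commute x y].

Definition abelian_set A : Prop := forall x y, A x -> A y -> commute x y.

Definition normal_closure H : set G :=
  generated [set h ^ x | h in H & x in [set: G]].

Definition contranormal H : Prop := normal_closure H = setT.

Fixpoint lower_central H (n : nat) : set G :=
  if n is m.+1 then generated [set [~ x, y] | x in lower_central H m & y in H]
  else H.

Definition nilpotent H : Prop := exists n, lower_central H n = [set 1].

Record normalSubgroup := NormalSubgroup {
  nsg_set :> set G;
  nsg_subgroup : subgroup nsg_set;
  nsg_conj : forall h x, nsg_set h -> nsg_set (h ^ x)
}.

End Subgroups.

Arguments finitely_generated G : clear implicits.
Arguments center G : clear implicits.

Definition contranormal_free (G : groupType) : Prop :=
  forall H : set G, subgroup H -> contranormal H -> H = setT.

Section Quotient.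
Variables (G : groupType) (N : normalSubgroup G).

Definition same_coset (x y : G) : bool := `[< nsg_set N (x^-1 * y) >].

Let NM x y : nsg_set N x -> nsg_set N y -> nsg_set N (x * y).
Proof. by case: (nsg_subgroup N) => _ + _; apply. Qed.
Let NV x : nsg_set N x -> nsg_set N x^-1.
Proof. by case: (nsg_subgroup N) => _ _; apply. Qed.

Lemma same_coset_refl : reflexive same_coset.
Proof. by move=> x; apply/asboolP; rewrite mulVg; case: (nsg_subgroup N). Qed.

Lemma same_coset_sym : symmetric same_coset.
Proof.
by move=> x y; apply/asboolP/asboolP => /NV; rewrite invgM invgK.
Qed.

Lemma same_coset_trans : transitive same_coset.
Proof.
move=> y x z /asboolP xy /asboolP yz; apply/asboolP.
by have := NM xy yz; rewrite -mulgA mulVKg.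
Qed.

Canonical same_coset_equiv :=
  EquivRel same_coset same_coset_refl same_coset_sym same_coset_trans.

Definition quotient_group := {eq_quot same_coset}.

HB.instance Definition _ := Choice.copy quotient_group {eq_quot same_coset}.

Definition coset_of (x : G) : quotient_group := \pi_{eq_quot same_coset} x.

Lemma coset_ofP x y : coset_of x = coset_of y <-> nsg_set N (x^-1 * y).
Proof. by split=> [/eqmodP/asboolP|xy] //; apply/eqmodP/asboolP. Qed.

Definition coset_one : quotient_group := coset_of 1.
Definition coset_inv (u : quotient_group) : quotient_group :=
  coset_of (repr u)^-1.
Definition coset_mul (u v : quotient_group) : quotient_group :=
  coset_of (repr u * repr v).

Lemma coset_reprK u : coset_of (repr u) = u.
Proof. exact: reprK. Qed.

Lemma coset_mulE x y : coset_mul (coset_of x) (coset_of y) = coset_of (x * y).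
Proof.
apply/coset_ofP; rewrite invgM.
have /coset_ofP Nx := coset_reprK (coset_of x).
have /coset_ofP Ny := coset_reprK (coset_of y).
set a := repr _ in Nx *; set b := repr _ in Ny *.
have := NM (nsg_conj b Nx) Ny.
by rewrite conjgE -!mulgA mulVKg.
Qed.

Lemma coset_invE x : coset_inv (coset_of x) = coset_of x^-1.
Proof.
apply/coset_ofP; rewrite invgK.
have /coset_ofP Nx := coset_reprK (coset_of x).
set a := repr _ in Nx *.
have := nsg_conj a^-1 (NV Nx).
by rewrite conjgE invgM !invgK mulgK.
Qed.

Lemma coset_mulA : associative coset_mul.
Proof.
move=> u v w; rewrite -(coset_reprK u) -(coset_reprK v) -(coset_reprK w).
by rewrite !coset_mulE mulgA.
Qed.

Lemma coset_mul1 : left_id coset_one coset_mul.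
Proof. by move=> u; rewrite -(coset_reprK u) coset_mulE mul1g. Qed.

Lemma coset_mulr1 : right_id coset_one coset_mul.
Proof. by move=> u; rewrite -(coset_reprK u) coset_mulE mulg1. Qed.

Lemma coset_mulV : left_inverse coset_one coset_inv coset_mul.
Proof.
by move=> u; rewrite -(coset_reprK u) coset_invE coset_mulE mulVg.
Qed.

Lemma coset_mulrV : right_inverse coset_one coset_inv coset_mul.
Proof.
by move=> u; rewrite -(coset_reprK u) coset_invE coset_mulE mulgV.
Qed.

HB.instance Definition _ := isGroup.Build quotient_group
  coset_mulA coset_mul1 coset_mulr1 coset_mulV coset_mulrV.

Lemma coset_ofM : {morph coset_of : x y / x * y}.
Proof. by move=> x y; rewrite -coset_mulE. Qed.

End Quotient.

(* The subgroup M / N of G / N (for N contained in M). *)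
Definition factor (G : groupType) (M N : normalSubgroup G) :
  set (quotient_group N) := coset_of N @` M.
Arguments factor {G} M N _.

(* An ordinal-indexed sequence (Q_a)_{a <= gamma} is modelled by a function on
   a well-ordered type with least element [\bot] (the index 0) and greatest
   element [\top] (the index gamma); every set of ordinals {a | a <= gamma} is
   order-isomorphic to such a type and conversely. *)
Section Series.
Variables (d : Order.disp_t) (I : tbOrderType d).
Implicit Types a b c : I.

Definition is_succ a b : Prop := (a < b)%O /\ forall c, (a < c)%O -> (b <= c)%O.

Definition is_limit b : Prop := b <> \bot%O /\ forall a, ~ is_succ a b.

Record ascending_series (G : groupType) (Q : I -> normalSubgroup G) : Prop := {
  asc_wf : well_founded (fun a b => (a < b)%O);
  asc_bot : nsg_set (Q \bot%O) = [set 1];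
  asc_le : forall a b, (a <= b)%O -> Q a `<=` Q b;
  asc_limit : forall b, is_limit b ->
    nsg_set (Q b) = \bigcup_(a in [set a | (a < b)%O]) Q a
}.

Definition hyper_series (G : groupType) (Q : I -> normalSubgroup G) : Prop :=
  [/\ ascending_series Q, nsg_set (Q \top%O) = setT &
      forall a b, is_succ a b ->
        abelian_set (factor (Q b) (Q a)) \/ finite_set (factor (Q b) (Q a))].

Definition upper_central_series (G : groupType) (Z : I -> normalSubgroup G) :
    Prop :=
  ascending_series Z /\
  forall a b, is_succ a b ->
    nsg_set (Z b) = coset_of (Z a) @^-1` center (quotient_group (Z a)).

End Series.

Definition hyper_abelian_or_finite (G : groupType) : Prop :=
  exists (d : Order.disp_t) (I : tbOrderType d) (Q : I -> normalSubgroup G),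
    hyper_series Q.

Definition hypercentral (G : groupType) : Prop :=
  exists (d : Order.disp_t) (I : tbOrderType d) (Z : I -> normalSubgroup G),
    upper_central_series Z /\ nsg_set (Z \top%O) = setT.

(* Main.v *)
From HB Require Import structures.
From mathcomp Require Import all_boot all_order all_algebra.
From mathcomp Require fingroup morphism pgroup center sylow.
From mathcomp Require Import boolp classical_sets functions cardinality.
From mathcomp Require Import ring.
Require Import Defs.

(** Why the theorem holds.  [ucs N k] is the k-th term of the upper central
    series above the normal subgroup [N], so [nilpotent_mod N] says that the
    quotient by [N] is nilpotent.

    A contranormal-free group passes this property to its quotients, and it
    produces contradictions through supplements: if [A] is an abelian normal
    subgroup with [A = [A, P]], then every [X] with [P = X A] is contranormal
    ([supplement_contranormal]), hence equal to [P].

    The engine is a statement about modules ([perfect_everywhere], in group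
    language [abelian_normal_perfect]).  Let a finitely generated nilpotent
    group act on an abelian group [V], let [I] be the augmentation ideal, and
    let [a] be an element that no power of [I] kills although its image in
    every proper quotient module is killed by some power of [I].  Then every
    [v] in [V] lies in [I v], and [a] lies in every nonzero submodule.  Its proof
    takes the first generator [z] of a central series of the acting group that
    moves [a], so that [x = z - 1] is an endomorphism of the cyclic module [C]
    generated by [a].  If no polynomial [1 + X q] killed [C], all of them would
    act bijectively on [C]; a weak form of P. Hall's generic freeness theorem
    ([generically_flat_adjoin], proved along the central series by the leading
    coefficient argument of Hilbert's basis theorem) forbids this.  So some
    [1 + x q(x)] vanishes on [C] ([central_annihilator]), which gives [C = I C];
    a Fitting argument, available because cyclic modules are noetherian,
    spreads this from [C] to all of [V].

    The engine is applied twice.  First, a finitely generated contranormal-free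
    group that is not nilpotent has a non-nilpotent quotient all of whose proper
    quotients are nilpotent.  An abelian normal subgroup [A <> 1] of that quotient would
    contain a minimal normal noncentral subgroup [V], and [V] has a proper
    supplement ([proper_supplement]), which is impossible; a finite normal
    subgroup would yield an abelian one by Frattini's argument
    ([finite_normal_abelian]).  As the first step of a hyper (abelian or finite)
    series outside a normal subgroup is one or the other, [G / L] is nilpotent
    ([fg_hyper_nilpotent]).  Second, if [A] is abelian and normal in a
    contranormal-free [P], and [P / A] is finitely generated and nilpotent, but
    some [a] in [A] lies in no [ucs 1 k], then after factoring out a maximal
    normal subgroup below [A] with the same property the engine gives
    [A = [A, P]].  A finitely generated supplement of [A] is then all of [P], and
    the first application makes [P] nilpotent, a contradiction
    ([locally_central_abelian]).

    Applied to [G / L'], the second step puts each element of [L] into some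
    [ucs L' k].  Bilinearity of commutators carries this to every factor of the
    lower central series of [L] ([lower_central_ucs]), so [L] lies in the
    hypercentre; as [G / L] is nilpotent, the hypercentre is [G]. *)

Set Implicit Arguments.
Unset Strict Implicit.
Unset Printing Implicit Defensive.

Import Order.TTheory.

Local Open Scope classical_set_scope.
Local Open Scope group_scope.

(** * Normal subgroups and relative upper central series *)

Section Subgroups.
Variable G : groupType.
Implicit Types (A B H K M N : set G) (x y z g h : G).

Lemma subgroup1 H : subgroup H -> H 1. Proof. by case. Qed.
Lemma subgroupM H x y : subgroup H -> H x -> H y -> H (x * y).
Proof. by case=> _ HM _; apply: HM. Qed.
Lemma subgroupV H x : subgroup H -> H x -> H x^-1.
Proof. by case=> _ _; apply. Qed.
Lemma subgroupMr H x y : subgroup H -> H y -> H (x * y) -> H x.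
Proof. by move=> sH Hy Hxy; rewrite -(mulgK y x); apply: subgroupM => //; apply: subgroupV. Qed.
Lemma subgroupJ H x y : subgroup H -> H x -> H y -> H (x ^ y).
Proof. by move=> sH Hx Hy; rewrite conjgE; do !apply: subgroupM => //; apply: subgroupV. Qed.

Lemma generated_subgroup A : subgroup (generated A).
Proof.
split=> [H [sH _]|x y gx gy H [sH sA]|x gx H [sH sA]]; first exact: subgroup1.
  by apply: subgroupM => //; [apply: gx | apply: gy].
by apply: subgroupV => //; apply: gx.
Qed.

Lemma sub_generated A : A `<=` generated A.
Proof. exact: sub_gen_smallest. Qed.

Lemma generated_sub A H : subgroup H -> A `<=` H -> generated A `<=` H.
Proof. exact: smallest_sub. Qed.

Definition is_normal N : Prop := subgroup N /\ forall h x, N h -> N (h ^ x).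

Lemma nsg_normal (N : normalSubgroup G) : is_normal N.
Proof. by split; [exact: nsg_subgroup | move=> h x; apply: nsg_conj]. Qed.

Lemma normal_conjr N h x : is_normal N -> N (h ^ x) -> N h.
Proof. by case=> _ Nj /(Nj _ x^-1); rewrite conjgK. Qed.

Lemma normalRl N h x : is_normal N -> N h -> N [~ h, x].
Proof.
case=> sN Nj Nh; rewrite commgEl; apply: subgroupM => //.
  exact: subgroupV.
exact: Nj.
Qed.

Lemma normalRr N h x : is_normal N -> N h -> N [~ x, h].
Proof.
case=> sN Nj Nh; rewrite commgEr; apply: subgroupM => //.
by apply: Nj; apply: subgroupV.
Qed.

Lemma generated_normal A : (forall h x, A h -> generated A (h ^ x)) ->
  is_normal (generated A).
Proof.
move=> Aj; have sA := generated_subgroup A; split=> // h x.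
have: subgroup [set h | generated A (h ^ x)].
  split=> [|u v|u] /=; rewrite ?conj1g ?conjMg ?conjVg; first exact: subgroup1.
    exact: subgroupM.
  exact: subgroupV.
by move/generated_sub; apply=> u; apply: Aj.
Qed.

(** [ucs N k] is the full preimage of the k-th term of the upper central
    series of the quotient by [N]; no quotient type is formed, so that the
    terms for different [N] can be compared. *)
Fixpoint ucs N (k : nat) : set G :=
  if k is k'.+1 then [set g | forall y, ucs N k' [~ g, y]] else N.

Lemma commMg_conj x y z : [~ x * y, z] = [~ x, z] ^ y * [~ y, z].
Proof. by rewrite !commgEl conjMg invgM conjMg !conjgE !mulgA !mulgK. Qed.

Lemma commgM_conj x y z : [~ x, y * z] = [~ x, z] * [~ x, y] ^ z.
Proof. by rewrite !commgEl conjMg conjgM conjVg -mulgA mulVKg. Qed.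

Lemma ucs_step_normal N : is_normal N -> is_normal [set g | forall y, N [~ g, y]].
Proof.
move=> nN; have [sN Nj] := nN; split; last first.
  by move=> h x Nh y; rewrite -[y](conjgKV x) -conjRg; apply: Nj.
split=> [y|u v Nu Nv y|u Nu y] /=.
- by rewrite comm1g; apply: subgroup1.
- by rewrite commMg_conj; apply: subgroupM => //; apply: Nj.
apply: (normal_conjr (x := u)) => //.
have := commMg_conj u^-1 u y; rewrite mulVg comm1g => e.
apply: (subgroupMr (y := [~ u, y])) => //; rewrite -e; exact: subgroup1.
Qed.

Lemma ucs_normal N k : is_normal N -> is_normal (ucs N k).
Proof. by move=> nN; elim: k => //= k; apply: ucs_step_normal. Qed.

Lemma ucsS N k : is_normal N -> ucs N k `<=` ucs N k.+1.
Proof. by move=> nN g Ug y; apply: normalRl Ug; apply: ucs_normal. Qed.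

Lemma ucs_le N j k : is_normal N -> (j <= k)%N -> ucs N j `<=` ucs N k.
Proof.
move=> nN /subnK <-; elim: (k - j)%N => // i IHi g Ug.
by rewrite addSn; apply: ucsS => //; apply: IHi.
Qed.

Lemma ucs_mono N M k : N `<=` M -> ucs N k `<=` ucs M k.
Proof. by move=> NM; elim: k => //= k IHk g Ug y; apply/IHk/Ug. Qed.

Lemma ucs_add N j k : ucs N (j + k) = ucs (ucs N j) k.
Proof. by elim: k => [|k IHk] /=; rewrite ?addn0 // addnS /= IHk. Qed.

(** [central_tower K0 setT] says that the quotient by [K0] has a finite central
    series with cyclic factors.  Each step adjoins one generator, which is the
    form needed for inductions that treat one operator at a time. *)
Inductive central_tower K0 : set G -> Prop :=
| tower_base : central_tower K0 K0
| tower_step K h : central_tower K0 K -> (forall g, K [~ h, g]) ->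
    central_tower K0 (generated (K `|` [set h])).

Lemma central_tower_normal K0 K : is_normal K0 -> central_tower K0 K -> is_normal K.
Proof.
move=> nK0; elim=> {K} [|K h _ [sK Kj] Kh] //.
apply: generated_normal => g x [Kg|->]; first by apply: sub_generated; left; apply: Kj.
rewrite (_ : h ^ x = h * [~ h, x]); last by rewrite commgEl mulVKg.
apply: (subgroupM (generated_subgroup _)).
  by apply: sub_generated; right.
by apply: sub_generated; left.
Qed.

End Subgroups.

(** * Quotients and contranormal subgroups *)

Section QuotientFacts.
Variables (G : groupType) (N : normalSubgroup G).
Implicit Types (x y g : G).
Local Notation cs := (coset_of N).

Lemma coset_of1 : cs 1 = 1. Proof. by []. Qed.

Lemma coset_ofV x : cs x^-1 = (cs x)^-1.
Proof. by apply: (mulgI (cs x)); rewrite -coset_ofM !mulgV. Qed.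

Lemma coset_ofJ x y : cs (x ^ y) = cs x ^ cs y.
Proof. by rewrite !conjgE !coset_ofM coset_ofV. Qed.

Lemma coset_ofR x y : cs [~ x, y] = [~ cs x, cs y].
Proof. by rewrite !commgEl coset_ofM coset_ofV coset_ofJ. Qed.

Lemma coset_of_eq1 x : cs x = 1 <-> nsg_set N x.
Proof.
rewrite -coset_of1; split=> [/esym/coset_ofP|Nx]; first by rewrite invg1 mul1g.
by apply/esym/coset_ofP; rewrite invg1 mul1g.
Qed.

Lemma coset_of_surj (u : quotient_group N) : exists x, cs x = u.
Proof. by exists (repr u); rewrite coset_reprK. Qed.

Lemma subgroup_preim (H : set (quotient_group N)) :
  subgroup H -> subgroup (cs @^-1` H).
Proof.
move=> sH; split=> [|x y Hx Hy|x Hx] /=; first exact: (subgroup1 sH).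
  by rewrite coset_ofM; apply: (subgroupM sH).
by rewrite coset_ofV; apply: (subgroupV sH).
Qed.

Lemma normal_preim (H : set (quotient_group N)) :
  is_normal H -> is_normal (cs @^-1` H).
Proof.
move=> [sH Hj]; split; first exact: subgroup_preim.
by move=> h x Hh /=; rewrite coset_ofJ; apply: Hj.
Qed.

Lemma subgroup_im (H : set G) : subgroup H -> subgroup (cs @` H).
Proof.
move=> sH; split=> [|_ _ [x Hx <-] [y Hy <-]|_ [x Hx <-]].
- by exists 1; [exact: subgroup1 | ].
- by exists (x * y); [exact: subgroupM | rewrite coset_ofM].
- by exists x^-1; [exact: subgroupV | rewrite coset_ofV].
Qed.

Lemma normal_im (H : set G) : is_normal H -> is_normal (cs @` H).
Proof.
move=> [sH Hj]; split; first exact: subgroup_im.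
move=> _ u [x Hx <-]; have [y <-] := coset_of_surj u.
by exists (x ^ y); rewrite ?coset_ofJ //; apply: Hj.
Qed.

Lemma ucs_preim (H : set (quotient_group N)) k x :
  ucs H k (cs x) <-> ucs (cs @^-1` H) k x.
Proof.
elim: k x => //= k IHk x; split=> U y; first by apply/IHk; rewrite coset_ofR.
by have [z <-] := coset_of_surj y; rewrite -coset_ofR; apply/IHk.
Qed.

Lemma ucs_quotient k x : ucs [set 1] k (cs x) <-> ucs N k x.
Proof.
rewrite ucs_preim; suff -> : cs @^-1` [set 1] = N by [].
by apply/seteqP; split=> y /=; rewrite coset_of_eq1.
Qed.

Lemma preim_im (H : set G) : subgroup H -> N `<=` H -> cs @^-1` (cs @` H) = H.
Proof.
move=> sH NH; apply/seteqP; split=> x; last by move=> Hx; exists x.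
case=> y Hy /coset_ofP Nyx; rewrite -(mulVKg y x).
by apply: subgroupM => //; apply: NH.
Qed.

Lemma normal_closure_normal (H : set G) : is_normal (normal_closure H).
Proof.
apply: generated_normal => _ x [h Hh [y _ <-]].
by apply: sub_generated; exists h => //; exists (y * x) => //; rewrite conjgM.
Qed.

End QuotientFacts.

Lemma sub_normal_closure (G : groupType) (H : set G) : H `<=` normal_closure H.
Proof.
by move=> h Hh; apply: sub_generated; exists h => //; exists 1 => //; rewrite conjg1.
Qed.

Lemma normal_closure_sub (G : groupType) (H N : set G) :
  is_normal N -> H `<=` N -> normal_closure H `<=` N.
Proof.
move=> [sN Nj] HN; apply: generated_sub => // _ [h Hh [x _ <-]].
exact/Nj/HN.
Qed.

(** The preimage [K] of a contranormal subgroup contains [N], so its normal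
    closure, which covers the quotient, is the whole group. *)
Lemma contranormal_free_quotient (G : groupType) (N : normalSubgroup G) :
  contranormal_free G -> contranormal_free (quotient_group N).
Proof.
move=> cf H sH cH; pose K := coset_of N @^-1` H.
have sK : subgroup K by apply: subgroup_preim.
have NK : N `<=` K by move=> x Nx; rewrite /K /= (coset_of_eq1 N x).2 //; apply: subgroup1.
suff KT : K = setT.
  apply/seteqP; split=> // u _; have [x <-] := coset_of_surj u.
  by have : K x by rewrite KT.
apply: cf => //; apply/seteqP; split=> // g _.
have nK := normal_closure_normal K; have KnK := @sub_normal_closure G K.
have [g' Ng' /coset_ofP Ng] : (coset_of N @` normal_closure K) (coset_of N g).
  suff : setT `<=` coset_of N @` normal_closure K by apply.
  rewrite -cH; apply: normal_closure_sub; first exact: normal_im.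
  move=> u Hu; have [x xu] := coset_of_surj u; exists x => //.
  by apply: KnK; rewrite /K /= xu.
rewrite -(mulVKg g' g); apply: (subgroupM nK.1) => //.
by apply: KnK; apply: NK.
Qed.

(** * Commutator words, chains of normal subgroups and central towers *)

Section Words.
Variable G : groupType.
Implicit Types (A W K N M : set G) (x y g h t : G) (X s : seq G).

Lemma commg_subgroup N g : is_normal N -> subgroup [set y | N [~ g, y]].
Proof.
move=> [sN Nj]; split=> [|x y Nx Ny|x Nx] /=.
- by rewrite commg1; apply: subgroup1.
- by rewrite commgM_conj; apply: subgroupM => //; apply: Nj.
have e : [~ g, x^-1] * [~ g, x] ^ x^-1 = 1 by rewrite -commgM_conj mulgV commg1.
apply: (subgroupMr (y := [~ g, x] ^ x^-1)) => //; first exact: Nj.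
by rewrite e; apply: subgroup1.
Qed.

Lemma generates_ind A X N : subgroup N -> generated (A `|` [set` X]) = setT ->
  A `<=` N -> (forall x, x \in X -> N x) -> forall y, N y.
Proof.
move=> sN gT AN XN y; have : [set: G] y by [].
by rewrite -gT; apply: generated_sub => // z [/AN|/XN].
Qed.

Fixpoint comm_words X k g : seq G :=
  if k is k'.+1 then flatten [seq comm_words X k' [~ g, x] | x <- X] else [:: g].

(** Membership of [g] in [ucs N k] is a condition on finitely many elements:
    [ucs N k [~ g, y]] holds for [y] in a subgroup, so it suffices to test
    [y] in [X] once the elements of [A] act trivially.  The set [W] keeps the
    successive commutators in the range where they do; it is everything for
    [A = 1], and [A] itself when [A] is abelian. *)
Lemma ucs_words A W N X k g : is_normal N ->
  generated (A `|` [set` X]) = setT ->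
  (forall w x, W w -> W [~ w, x]) -> (forall w a, W w -> A a -> [~ w, a] = 1) ->
  W g -> ucs N k g <-> forall y, y \in comm_words X k g -> N y.
Proof.
move=> nN gT Wc WA; elim: k g => /= [|k IHk] g Wg.
  by split=> [Ng y|]; [rewrite inE => /eqP-> | apply; rewrite inE].
have nU := ucs_normal k nN.
split=> [U y /flatten_mapP[x Xx yx]|Nw].
  by move: y yx; apply/IHk => //; apply: Wc.
apply: (generates_ind (commg_subgroup g nU) gT) => [a Aa|x Xx] /=.
  by rewrite WA //; apply: subgroup1 nU.1.
apply/IHk; first exact: Wc.
by move=> y yx; apply: Nw; apply/flatten_mapP; exists x.
Qed.

Lemma chain_finite (F : set (set G)) s : F !=set0 -> total_on F subset ->
  (forall y, y \in s -> (\bigcup_(N in F) N) y) ->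
  exists2 N, F N & forall y, y \in s -> N y.
Proof.
move=> [N0 FN0] totF; elim: s => [|x s IHs] Us; first by exists N0.
have [|N FN Ns] := IHs; first by move=> y ys; apply: Us; rewrite inE ys orbT.
have [M FM Mx] := Us x (mem_head _ _).
case: (totF N M FN FM) => sub.
  by exists M => // y; rewrite inE => /orP[/eqP->|/Ns/sub].
by exists N => // y; rewrite inE => /orP[/eqP->|/Ns //]; apply: sub.
Qed.

Lemma normal_bigcup (F : set (set G)) : F !=set0 -> total_on F subset ->
  (forall N, F N -> is_normal N) -> is_normal (\bigcup_(N in F) N).
Proof.
move=> [N0 FN0] totF nF; split; last first.
  by move=> h x [N FN Nh]; exists N => //; apply: (nF _ FN).2.
split=> [|x y [N FN Nx] [M FM My]|x [N FN Nx]].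
- by exists N0 => //; apply: subgroup1; apply: (nF _ FN0).1.
- case: (totF N M FN FM) => sub; [exists M | exists N] => //;
    apply: subgroupM; try exact: (nF _ _).1; by [|apply: sub].
- by exists N => //; apply: subgroupV => //; apply: (nF _ FN).1.
Qed.

(** The union over an empty chain is empty and is never good; adding the empty
    set as an extra member of the poset lets Zorn's lemma apply. *)
Lemma Zorn_nonempty (good : set G -> Prop) :
  (forall N, good N -> N 1) ->
  (forall F : set (set G), F !=set0 -> total_on F subset -> (forall N, F N -> good N) ->
     good (\bigcup_(N in F) N)) ->
  (exists N, good N) ->
  exists N, good N /\ forall M, good M -> N `<=` M -> M `<=` N.
Proof.
move=> good1 goodU [N0 gN0].
have [|N [gN Nmax]] := @Zorn_bigcup G [set N | good N \/ N = set0].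
  move=> F FP totF.
  have [[N [FN gN]]|noN] := pselect (exists N, F N /\ good N); last first.
    right; apply/seteqP; split=> // x [N FN Nx].
    case: (FP N FN) => [gN|N0']; first by case: noN; exists N.
    by rewrite N0' in Nx.
  left; pose F' := F `&` [set N | good N].
  have -> : \bigcup_(X in F) X = \bigcup_(X in F') X.
    apply/seteqP; split=> x [M]; last by case=> FM _ Mx; exists M.
    move=> FM Mx; exists M => //; split=> //.
    by case: (FP M FM) => // M0; rewrite M0 in Mx.
  apply: goodU; first by exists N.
    by move=> A B [FA _] [FB _]; apply: totF.
  by move=> M [].
have {}gN : good N.
  case: gN => // N0'; have : N `<` N0.
    split; first by rewrite N0'.
    by move/(_ 1 (good1 _ gN0)); rewrite N0'.
  by move/Nmax; case; left.
exists N; split=> // M gM NM; apply: contrapT => nMN.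
by apply: (Nmax M) => //; left.
Qed.

(** Left-normed commutators of weight [k.+1] in [X]. *)
Fixpoint weight_words X k : seq G :=
  if k is k'.+1 then flatten [seq [seq [~ t, x] | x <- X] | t <- weight_words X k']
  else X.

Lemma tower_add A K s : central_tower A K -> (forall t g, t \in s -> K [~ t, g]) ->
  exists K', [/\ central_tower A K', K `<=` K' & forall t, t \in s -> K' t].
Proof.
elim: s K => [|t s IHs] K twK Ks; first by exists K; split=> // t.
have Kg : K `<=` generated (K `|` [set t]) by move=> k Kk; apply: sub_generated; left.
have [||K' [twK' KK' sK']] := IHs (generated (K `|` [set t])).
- by apply: tower_step => // g; apply: Ks; rewrite mem_head.
- by move=> u g us; apply: Kg; apply: Ks; rewrite inE us orbT.
exists K'; split=> //; first by apply: subset_trans KK'.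
move=> u; rewrite inE => /orP[/eqP->|/sK' //].
by apply: KK'; apply: sub_generated; right.
Qed.

Lemma central_tower_sub A K : central_tower A K -> A `<=` K.
Proof.
by elim=> // {}K h _ AK _ a Aa; apply: sub_generated; left; apply: AK.
Qed.

(** Left-normed commutators of weight above [c] lie in [A].  Adjoining the
    commutators of weight [c], then [c - 1], and so on down to [X] itself gives a
    tower: for [t] of weight [k] the [g] with [[~ t, g]] already adjoined form
    a subgroup, which contains [X] because [[~ t, x]] has weight [k.+1]. *)
Lemma central_tower_exists A X c : is_normal A -> generated (A `|` [set` X]) = setT ->
  ucs A c = setT -> central_tower A setT.
Proof.
move=> nA gT Uc.
have wU k t : (k <= c)%N -> t \in weight_words X k -> ucs A (c - k) t.
  elim: k t => [|k IHk] t kc; first by rewrite subn0 Uc.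
  move=> /flatten_mapP[u uk /mapP[x _ ->]].
  have := IHk _ (ltnW kc) uk; rewrite -(subnSK kc); exact.
have [K [twK KX]] : exists K, central_tower A K /\ forall t, t \in weight_words X 0 -> K t.
  suff main i : (i <= c)%N -> exists K, central_tower A K /\
      forall t, t \in weight_words X (c - i) -> K t.
    by have := main c (leqnn c); rewrite subnn.
  elim: i => [_|i IHi ic].
    exists A; split; first exact: tower_base.
    by move=> t; rewrite subn0 => /(wU _ _ (leqnn c)); rewrite subnn.
  have [K [twK KP]] := IHi (ltnW ic).
  have nK := central_tower_normal nA twK.
  have [|K' [twK' _ K'P]] := tower_add (s := weight_words X (c - i.+1)) twK; last by exists K'.
  move=> t g tw.
  apply: (generates_ind (commg_subgroup t nK) gT) => [a Aa|x Xx] /=.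
    by apply: (normalRr _ nK); apply: central_tower_sub Aa.
  apply: KP; rewrite -(subnSK ic); apply/flatten_mapP; exists t => //.
  by apply/mapP; exists x.
suff <- : K = setT by [].
apply/seteqP; split=> // y _.
by apply: (generates_ind (central_tower_normal nA twK).1 gT); [apply: central_tower_sub | ].
Qed.

End Words.

(** * Operators on abelian groups and the action of integer polynomials *)

Section OperatorsPart.
Import GRing.Theory Num.Theory.
Local Open Scope ring_scope.

Section Operators.
Variable V : zmodType.
Implicit Types (B N L C : set V) (O : set (V -> V)) (x t o : V -> V).
Implicit Types (u v w : V) (p q : {poly int}).

Definition addsub B : Prop := B 0 /\ forall u v, B u -> B v -> B (u - v).

(** Additive maps, as a predicate on bare functions: the operators below come
    from group elements and polynomials and are compared as functions. *)
Definition subtractive o : Prop := {morph o : u v / u - v}.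

Definition opsub O B : Prop :=
  addsub B /\ forall o, O o -> forall v, B v -> B (o v).

Lemma addsub0 B : addsub B -> B 0. Proof. by case. Qed.

Lemma addsubB B u v : addsub B -> B u -> B v -> B (u - v).
Proof. by case=> _; apply. Qed.

Lemma addsubN B u : addsub B -> B u -> B (- u).
Proof. by move=> Bs Bu; rewrite -[- u]add0r; apply: addsubB Bs (addsub0 Bs) Bu. Qed.

Lemma addsubD B u v : addsub B -> B u -> B v -> B (u + v).
Proof. by move=> Bs Bu Bv; rewrite -[v]opprK; apply: addsubB => //; apply: addsubN. Qed.

Lemma addsubMn B u n : addsub B -> B u -> B (u *+ n).
Proof.
move=> Bs Bu; elim: n => [|n IHn]; first by rewrite mulr0n; case: Bs.
by rewrite mulrS; apply: addsubD.
Qed.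

Lemma addsubMz B u z : addsub B -> B u -> B (u *~ z).
Proof.
move=> Bs Bu; case: z => n; rewrite ?NegzE ?mulrNz -pmulrn ?mulNrn; first exact: addsubMn.
by apply: addsubN => //; apply: addsubMn.
Qed.

Lemma addsub_sum B I r (P : pred I) (F : I -> V) :
  addsub B -> (forall i, P i -> B (F i)) -> B (\sum_(i <- r | P i) F i).
Proof.
move=> Bs BF; elim/big_rec: _ => [|i v Pi Bv]; first exact: addsub0.
by apply: addsubD => //; apply: BF.
Qed.

Lemma addsub_zero : addsub [set 0].
Proof. by split=> // u v -> ->; rewrite subr0. Qed.

Lemma subtr0 o : subtractive o -> o 0 = 0.
Proof. by move=> oB; rewrite -[in LHS](subrr 0) oB subrr. Qed.

Lemma subtrN o v : subtractive o -> o (- v) = - o v.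
Proof. by move=> oB; rewrite -[- v]sub0r oB subtr0 // sub0r. Qed.

Lemma subtrD o u v : subtractive o -> o (u + v) = o u + o v.
Proof. by move=> oB; rewrite -[v in LHS]opprK oB (subtrN v oB) opprK. Qed.

Lemma subtrMz o v z : subtractive o -> o (v *~ z) = o v *~ z.
Proof.
move=> oB; have oMn w n : o (w *+ n) = o w *+ n.
  elim: n => [|n IHn]; first by rewrite !mulr0n subtr0.
  by rewrite !mulrS subtrD // IHn.
by case: z => n; rewrite ?NegzE ?mulrNz -!pmulrn ?subtrN // oMn.
Qed.

Lemma subtr_sum o I r (P : pred I) (F : I -> V) :
  subtractive o -> o (\sum_(i <- r | P i) F i) = \sum_(i <- r | P i) o (F i).
Proof.
move=> oB; elim/big_ind2: _ => //; first exact: subtr0.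
by move=> u1 v1 u2 v2 <- <-; rewrite subtrD.
Qed.

Lemma subtr_iter o n : subtractive o -> subtractive (iter n o).
Proof. by move=> oB; elim: n => [|n IHn] u v //=; rewrite IHn oB. Qed.

(** The action of Z[X] on [V] in which X acts as [x]. *)
Definition pact x (p : {poly int}) (v : V) : V :=
  \sum_(i < size p) iter i x v *~ p`_i.

Lemma pactE x n p v : (size p <= n)%N ->
  pact x p v = \sum_(i < n) iter i x v *~ p`_i.
Proof.
move=> le_pn; rewrite /pact (big_ord_widen n (fun i => iter i x v *~ p`_i)) //.
rewrite big_mkcond /=; apply: eq_bigr => i _.
by case: ltnP => // /(nth_default 0) ->; rewrite mulr0z.
Qed.

Lemma pactD x p q v : pact x (p + q) v = pact x p v + pact x q v.
Proof.
pose n := maxn (size p) (size q).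
rewrite (@pactE x n (p + q)) ?size_polyD // (@pactE x n p) ?leq_maxl //.
rewrite (@pactE x n q) ?leq_maxr // -big_split; apply: eq_bigr => i _.
by rewrite coefD mulrzDr.
Qed.

Lemma pact0 x v : pact x 0 v = 0.
Proof. by rewrite /pact size_poly0 big_ord0. Qed.

Lemma pactN x p v : pact x (- p) v = - pact x p v.
Proof.
by apply/eqP; rewrite -addr_eq0 -pactD addNr pact0.
Qed.

Lemma pactB x p q v : pact x (p - q) v = pact x p v - pact x q v.
Proof. by rewrite pactD pactN. Qed.

Lemma pactCM x c p v : pact x (c%:P * p) v = pact x p v *~ c.
Proof.
rewrite (@pactE x (size p)); last first.
  by rewrite mul_polyC; apply: size_scale_leq.
rewrite /pact mulrz_suml; apply: eq_bigr => i _.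
by rewrite coefCM mulrC mulrzA.
Qed.

Lemma pact1 x v : pact x 1 v = v.
Proof. by rewrite /pact size_poly1 big_ord1 coef1 /= mulr1z. Qed.

Lemma pactC x c v : pact x c%:P v = v *~ c.
Proof. by rewrite -[c%:P]mulr1 pactCM pact1. Qed.

Section PolyAct.
Variable x : V -> V.
Hypothesis xB : subtractive x.

Lemma pactXM p v : pact x ('X * p) v = x (pact x p v).
Proof.
rewrite (@pactE x (size p).+1); last first.
  by rewrite mulrC; have [->|p0] := eqVneq p 0;
     [rewrite mul0r size_poly0 | rewrite size_mulX].
rewrite big_ord_recl coefXM /= mulr0z add0r /pact subtr_sum //.
by apply: eq_bigr => i _; rewrite coefXM /= subtrMz.
Qed.

Lemma pactX v : pact x 'X v = x v.
Proof. by rewrite -['X]mulr1 pactXM pact1. Qed.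

Lemma pactM p q v : pact x (p * q) v = pact x p (pact x q v).
Proof.
elim/poly_ind: p q v => [|p c IHp] q v; first by rewrite mul0r !pact0.
rewrite mulrDl !pactD pactCM pactC -mulrA !IHp.
by rewrite pactXM pactX.
Qed.

Lemma pact_subtractive p : subtractive (pact x p).
Proof.
move=> u v; rewrite /pact -sumrB; apply: eq_bigr => i _.
by rewrite (subtr_iter i xB) mulrzBl.
Qed.

Lemma pact_exp p n v : pact x (p ^+ n) v = iter n (pact x p) v.
Proof. by elim: n => [|n IHn] /=; rewrite ?pact1 // exprS pactM IHn. Qed.

Lemma pact_closed B p v : addsub B -> (forall u, B u -> B (x u)) ->
  B v -> B (pact x p v).
Proof.
move=> Bs Bx Bv; apply: addsub_sum => // i _; apply: addsubMz => //.
by elim: (nat_of_ord i) => //= n; apply: Bx.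
Qed.

Lemma pact_comm C y p v : subtractive y ->
  (forall u, C u -> C (x u)) -> (forall u, C u -> y (x u) = x (y u)) ->
  C v -> y (pact x p v) = pact x p (y v).
Proof.
move=> yB Cx yx Cv; rewrite subtr_sum //; apply: eq_bigr => i _.
rewrite subtrMz //; congr (_ *~ _).
have Ci n : C (iter n x v) by elim: n => //= n; apply: Cx.
by elim: (nat_of_ord i) => //= n <-; rewrite yx.
Qed.

End PolyAct.
End Operators.

End OperatorsPart.

(** * Leading coefficients: the basis theorem and generic flatness *)

Section FlatnessPart.
Import GRing.Theory Num.Theory.
Local Open Scope ring_scope.

Section Noetherian.
Variable V : zmodType.
Implicit Types (B N L C : set V) (O : set (V -> V)) (x t o : V -> V).
Implicit Types (u v w : V) (f g p q : {poly int}).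

Definition noetherian O N : Prop :=
  forall B : nat -> set V, (forall i, opsub O (B i)) -> (forall i, B i `<=` N) ->
    (forall i, B i `<=` B i.+1) -> exists n, forall m, (n <= m)%N -> B m `<=` B n.

Lemma chain_le (B : nat -> set V) i j :
  (forall i, B i `<=` B i.+1) -> (i <= j)%N -> B i `<=` B j.
Proof.
move=> Bi /subnK <-; elim: (j - i)%N => // k IHk v Bv.
by rewrite addSn; apply/Bi/IHk.
Qed.

Variables (O : set (V -> V)) (t : V -> V) (C N : set V).

(** The situation of a skew polynomial extension: the operator [t] normalizes the
    operators in [O], but only on an ambient subgroup [C] that contains
    everything of interest.  A group element and its inverse are adjoined one
    after the other. *)
Record adjoinable : Prop := Adjoinable {
  adj_op : forall o, O o -> subtractive o;
  adj_t : subtractive t;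
  adj_C : opsub O C;
  adj_Ct : forall v, C v -> C (t v);
  adj_N : opsub O N;
  adj_NC : N `<=` C;
  adj_left : forall o, O o ->
    exists2 o', O o' & forall v, C v -> t (o v) = o' (t v);
  adj_right : forall o, O o ->
    exists2 o', O o' & forall v, C v -> o (t v) = t (o' v)
}.

Hypothesis tP : adjoinable.
Let OB := adj_op tP.
Let tB := adj_t tP.
Let CO := adj_C tP.
Let Ct := adj_Ct tP.
Let NO := adj_N tP.
Let NC := adj_NC tP.
Let Ns : addsub N := NO.1.

(** [layer j] is N + t N + ... + t^(j-1) N. *)
Fixpoint layer j : set V :=
  if j is i.+1 then
    [set v | exists n w, [/\ N n, layer i w & v = iter i t n + w]]
  else [set 0].

Definition adjoin : set V := [set v | exists j, layer j v].

(** The [j]-th ideal of leading coefficients of [B]. *)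
Definition lead B j : set V :=
  [set n | N n /\ exists2 w, layer j w & B (iter j t n + w)].

Let tiB i : subtractive (iter i t) := subtr_iter i tB.

Let Cti i v : C v -> C (iter i t v).
Proof. by move=> Cv; elim: i => //= i; apply: Ct. Qed.

Lemma layer_addsub j : addsub (layer j).
Proof.
elim: j => [|j IHj] /=; first exact: addsub_zero.
split=> [|_ _ [n1 [w1 [Nn1 lw1 ->]]] [n2 [w2 [Nn2 lw2 ->]]]].
  by exists 0, 0; split; [exact: addsub0 | exact: addsub0 | rewrite (subtr0 (tiB j)) addr0].
exists (n1 - n2), (w1 - w2); split; [exact: addsubB | exact: addsubB |].
by rewrite tiB opprD addrACA.
Qed.

Lemma layer_subC j : layer j `<=` C.
Proof.
elim: j => [|j IHj] v /=; first by move->; apply: addsub0 CO.1.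
case=> n [w [Nn lw ->]]; apply: addsubD CO.1 _ (IHj _ lw).
exact/Cti/NC.
Qed.

Lemma iter_right j o : O o ->
  exists2 o', O o' & forall v, C v -> o (iter j t v) = iter j t (o' v).
Proof.
elim: j o => [|j IHj] o Oo; first by exists o.
have [o1 Oo1 o1E] := adj_right tP Oo; have [o2 Oo2 o2E] := IHj _ Oo1.
by exists o2 => // v Cv; rewrite /= o1E ?o2E //; apply: Cti.
Qed.

Lemma iter_left j o : O o ->
  exists2 o', O o' & forall v, C v -> iter j t (o v) = o' (iter j t v).
Proof.
elim: j o => [|j IHj] o Oo; first by exists o.
have [o1 Oo1 o1E] := IHj _ Oo; have [o2 Oo2 o2E] := adj_left tP Oo1.
by exists o2 => // v Cv; rewrite /= o1E // o2E //; apply: Cti.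
Qed.

Lemma layer_op j : opsub O (layer j).
Proof.
split=> [|o Oo]; first exact: layer_addsub.
elim: j => [|j IHj] v /=; first by move->; apply/subtr0/OB.
case=> n [w [Nn lw ->]]; have [o' Oo' o'E] := iter_right j Oo.
exists (o' n), (o w); split; [exact: (NO.2) | exact: IHj |].
by rewrite (subtrD _ _ (OB Oo)) o'E //; apply: NC.
Qed.

Lemma layer_t j v : layer j v -> layer j.+1 (t v).
Proof.
elim: j v => [|j IHj] v.
  by move->; rewrite (subtr0 tB); apply: addsub0; apply: layer_addsub.
case=> n [w [Nn lw ->]]; exists n, (t w); split=> //; first exact: IHj.
by rewrite (subtrD _ _ tB).
Qed.

Lemma layerS j : layer j `<=` layer j.+1.
Proof.
by move=> v lv; exists 0, v; split=> //; [exact: addsub0 | rewrite (subtr0 (tiB j)) add0r].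
Qed.

Lemma layer_le i j : (i <= j)%N -> layer i `<=` layer j.
Proof. by move=> ij; apply: chain_le ij; apply: layerS. Qed.

Lemma adjoin_sub : N `<=` adjoin.
Proof.
by move=> v Nv; exists 1%N, v, 0; split=> //=; rewrite addr0.
Qed.

Lemma adjoin_subC : adjoin `<=` C.
Proof. by move=> v [j]; apply: layer_subC. Qed.

Lemma adjoin_opsub : opsub (O `|` [set t]) adjoin.
Proof.
split=> [|o Oto v [j lv]].
  split=> [|u v [i lu] [j lv]]; first by exists 0%N.
  exists (maxn i j); apply: addsubB (layer_addsub _) _ _.
    exact: layer_le (leq_maxl _ _) _ lu.
  exact: layer_le (leq_maxr _ _) _ lv.
case: Oto => [Oo|->]; last by exists j.+1; apply: layer_t.
by exists j; apply: (layer_op j).2.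
Qed.

Section Lead.
Variable B : set V.
Hypothesis BO : opsub (O `|` [set t]) B.
Let Bs : addsub B := BO.1.
Let Bo o v : O o -> B v -> B (o v).
Proof. by move=> Oo; apply: (BO.2 o); left. Qed.
Let Bt v : B v -> B (t v).
Proof. by apply: (BO.2 t); right. Qed.

Lemma lead_opsub j : opsub O (lead B j).
Proof.
split.
  split.
    split; first exact: addsub0.
    by exists 0; [exact: (addsub0 (layer_addsub j))|rewrite addr0 (subtr0 (tiB j)); exact: addsub0].
  move=> n1 n2 [Nn1 [w1 lw1 B1]] [Nn2 [w2 lw2 B2]]; split; first exact: addsubB.
  exists (w1 - w2); first by apply: addsubB => //; apply: layer_addsub.
  by rewrite tiB addrACA -opprD; apply: addsubB.
move=> o Oo n [Nn [w lw Bn]]; split; first exact: (NO.2).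
have [o' Oo' o'E] := iter_left j Oo.
exists (o' w); first exact: (layer_op j).2.
rewrite o'E; last exact: NC.
by rewrite -(subtrD _ _ (OB Oo')); apply: Bo.
Qed.

Lemma lead_sub j : lead B j `<=` N. Proof. by move=> n []. Qed.

Lemma leadS j : lead B j `<=` lead B j.+1.
Proof.
move=> n [Nn [w lw Bn]]; split=> //; exists (t w); first exact: layer_t.
by rewrite /= -(subtrD _ _ tB); apply: Bt.
Qed.

Lemma lead_le i j : (i <= j)%N -> lead B i `<=` lead B j.
Proof. by move=> ij; apply: chain_le ij; apply: leadS. Qed.

End Lead.

Lemma lead_mono B B' j : B `<=` B' -> lead B j `<=` lead B' j.
Proof. by move=> sB n [Nn [w lw Bn]]; split=> //; exists w => //; apply: sB. Qed.

(** Two nested submodules with the same leading coefficients agree: subtract from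
    an element of the larger one an element of the smaller one with the same
    leading term and argue by induction on the degree. *)
Lemma lead_determines B B' : addsub B -> addsub B' -> B `<=` B' ->
  (forall j, lead B' j `<=` lead B j) -> B' `<=` adjoin -> B' `<=` B.
Proof.
move=> Bs B's sBB' leadB B'a v B'v; have [j lv] := B'a _ B'v.
elim: j => [|j IHj] in v lv B'v *; first by rewrite lv; apply: addsub0.
case: lv => n [w [Nn lw vE]].
have [|_ [w' lw' Bn]] := leadB j n; first by split=> //; exists w; rewrite -?vE.
have wE : v - (iter j t n + w') = w - w' by rewrite vE opprD addrACA subrr add0r.
have : B (w - w').
  apply: IHj; first by apply: addsubB => //; apply: layer_addsub.
  by rewrite -wE; apply: addsubB => //; apply: sBB'.
by rewrite -wE => /(addsubD Bs Bn); rewrite addrC subrK.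
Qed.

(** Hilbert's basis theorem.  The double sequence [lead (B i) j] increases in both
    indices; it is constant from [n0] on along the diagonal, and for the
    finitely many [j < n0] it is stationary in [i]. *)
Theorem noetherian_adjoin : noetherian O N -> noetherian (O `|` [set t]) adjoin.
Proof.
move=> noeN B BO Ba BS.
have Ble i j : (i <= j)%N -> B i `<=` B j by apply: chain_le.
have leadBle i j k l : (i <= j)%N -> (k <= l)%N -> lead (B i) k `<=` lead (B j) l.
  move=> ij kl n /(lead_mono (Ble _ _ ij)).
  by apply: lead_le.
have [|||n0 n0P] := noeN (fun k => lead (B k) k).
- by move=> i; apply: lead_opsub.
- by move=> i; apply: lead_sub.
- by move=> i; apply: leadBle.
have [k kP] : exists k, forall j, (j < n0)%N -> forall m, (k <= m)%N ->
    lead (B m) j `<=` lead (B k) j.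
  elim: (n0) => [|n [k kP]]; first by exists 0%N.
  have [|||k' k'P] := noeN (fun k => lead (B k) n).
  - by move=> i; apply: lead_opsub.
  - by move=> i; apply: lead_sub.
  - by move=> i; apply: leadBle.
  exists (maxn k k') => j le_jn m; rewrite geq_max => /andP[km k'm].
  move: le_jn; rewrite ltnS leq_eqVlt; case/orP=> [/eqP->|jn] u lu.
    by apply: (leadBle k') (k'P m _ _ _) => //; apply: leq_maxr.
  by apply: (leadBle k) (kP j _ m _ _ _) => //; apply: leq_maxl.
exists (maxn n0 k) => m; rewrite geq_max => /andP[n0m km].
apply: lead_determines (Ba m) => //; [exact: (BO _).1|exact: (BO _).1| |].
  by apply: Ble; rewrite geq_max n0m.
move=> j u lu; case: (ltnP j n0) => [jn0|n0j].
  by apply: (leadBle k) (kP j _ m _ _ _) => //; apply: leq_maxr.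
apply: (leadBle n0 _ n0) => //; first exact: leq_maxl.
apply: (n0P (maxn m j)); first by rewrite leq_max n0m.
by apply: leadBle lu; [apply: leq_maxl | apply: leq_maxr].
Qed.

Section Generic.
Variable x : V -> V.
Variables (nonzero : set {poly int}) (test : {poly int} -> {poly int} -> Prop).

(** For every [g] that passes the test against [f], the quotient [M / L] has no
    [g]-torsion and an element divisible by all powers of [g] is killed by a
    power of [f].  This is what remains of the freeness of [M / L] after
    inverting [f], in a form that survives extensions and ascending unions. *)
Definition flat_off f (M L : set V) : Prop :=
  forall g, test f g ->
    (forall n, M n -> L (pact x g n) -> L n) /\
    (forall n, M n -> (forall k, exists2 m, M m & L (n - pact x (g ^+ k) m)) ->
       exists e, L (pact x (f ^+ e) n)).

(** Every quotient of [M] becomes flat in the above sense after inverting one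
    polynomial that does not vanish, as in Hall's generic freeness. *)
Definition generically_flat O' (M : set V) : Prop :=
  forall L, opsub O' L -> L `<=` M -> exists2 f, nonzero f & flat_off f M L.

Hypothesis Ox : O x.
Hypothesis xt : forall v, C v -> t (x v) = x (t v).
Hypothesis nonzeroM : forall f f', nonzero f -> nonzero f' -> nonzero (f * f').
Hypothesis testM : forall f f' g, test (f * f') g -> test f g /\ test f' g.
Hypothesis noeN : noetherian O N.
Hypothesis flatN : generically_flat O N.

Let xB : subtractive x := OB Ox.
Let pB p : subtractive (pact x p) := pact_subtractive xB p.

Let ptE p j v : C v -> pact x p (iter j t v) = iter j t (pact x p v).
Proof.
move=> Cv; rewrite (pact_comm (y := iter j t) p (C := C)) //.
  by move=> u; apply: CO.2.
by elim: j => //= j IHj u Cu; rewrite IHj // xt //; apply: Cti.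
Qed.

Let opsub_pact L p v : opsub O L -> L v -> L (pact x p v).
Proof. by case=> Ls Lo; apply: pact_closed => // u; apply: Lo. Qed.

Lemma flat_offM f f' L : opsub O L -> flat_off f N L -> flat_off (f * f') N L.
Proof.
move=> LO flatf g /testM[/flatf[injg capg] _]; split=> // n Nn capn.
have [e fen] := capg n Nn capn; exists e.
by rewrite exprMn mulrC pactM //; apply: opsub_pact.
Qed.

(** By the chain condition the ideals of leading coefficients take finitely many
    values, and the product of the polynomials found for these works for all. *)
Lemma flat_off_lead B : opsub (O `|` [set t]) B ->
  exists2 f, nonzero f & forall j, flat_off f N (lead B j).
Proof.
move=> BO; have lO j := lead_opsub BO j.
have [||n nP] := noeN lO; [exact: lead_sub | exact: leadS |].
have [f nzf fP] : exists2 f, nonzero f & forall j, (j <= n)%N -> flat_off f N (lead B j).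
  elim: n {nP} => [|n [f nzf fP]].
    have [f nzf fP] := flatN (lO 0%N) (@lead_sub B 0%N).
    by exists f => // j; rewrite leqn0 => /eqP->.
  have [f' nzf' fP'] := flatN (lO n.+1) (@lead_sub B n.+1).
  exists (f * f'); first exact: nonzeroM.
  move=> j; rewrite leq_eqVlt ltnS => /orP[/eqP->|/fP].
    by rewrite mulrC; apply: flat_offM.
  exact: flat_offM.
exists f => // j; case: (leqP j n) => [/fP //|/ltnW nj].
suff -> : lead B j = lead B n by apply: fP.
by apply/seteqP; split; [apply: nP | apply: lead_le].
Qed.

Section Filtration.
Variables (B : set V) (f g : {poly int}).
Hypothesis BO : opsub (O `|` [set t]) B.
Hypothesis flatf : forall j, flat_off f N (lead B j).
Hypothesis fg : test f g.
Let Bs : addsub B := BO.1.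
Let Bp p v : B v -> B (pact x p v).
Proof. by apply: pact_closed => // u; apply: BO.2; left. Qed.
Let Np p v : N v -> N (pact x p v).
Proof. exact: opsub_pact NO. Qed.
Let lp p j v : layer j v -> layer j (pact x p v).
Proof. exact: opsub_pact (layer_op j). Qed.

(** The factor of consecutive layers modulo [B] is [N] modulo [lead B j], where
    [g] is injective. *)
Lemma layer_inj j v : layer j v -> B (pact x g v) -> B v.
Proof.
elim: j v => [|j IHj] v; first by move->; rewrite (subtr0 (pB g)).
case=> n [w [Nn lw ->]]; rewrite (subtrD _ _ (pB g)) (ptE _ _ (NC Nn)) => Bg.
have [|_ [w' lw' Bn]] := (flatf j fg).1 n Nn.
  by split; [exact: Np | exists (pact x g w); [exact: lp |]].
suff Bw : B (w - w') by have := addsubD Bs Bn Bw; rewrite addrACA subrr addr0 => //;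
  rewrite -addrA [w' + _]addrC subrK.
apply: IHj; first by apply: addsubB => //; apply: layer_addsub.
have := addsubB Bs Bg (Bp g Bn).
by rewrite (subtrD _ _ (pB g)) (ptE _ _ (NC Nn)) pB opprD addrACA subrr add0r.
Qed.

(** Injectivity of [g] on the factors above level [j] shows that [v]
    lies at level [j] modulo [B] as soon as its multiple by [g^k] does. *)
Lemma layer_descend i j k v : layer i v ->
  (exists2 w, layer j w & B (pact x (g ^+ k) v - w)) ->
  exists2 v', layer j v' & B (v - v').
Proof.
have step l u : layer l u -> (exists2 w, layer j w & B (pact x g u - w)) ->
    exists2 u', layer j u' & B (u - u').
  elim: l u => [|l IHl] u lu [w lw Bw].
    exists 0; first exact: addsub0 (layer_addsub j).
    by rewrite (_ : u = 0) // subr0; apply: addsub0.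
  case: (leqP l.+1 j) => [lj|]; first by exists u; [exact: layer_le lu|rewrite subrr; apply: addsub0].
  rewrite ltnS => jl; case: lu => n [w0 [Nn lw0 uE]].
  have Cn := NC Nn.
  have [|_ [w1 lw1 Bn]] := (flatf l fg).1 n Nn.
    split; first exact: Np.
    exists (pact x g w0 - w).
      by apply: addsubB; [exact: layer_addsub | exact: lp | exact: layer_le lw].
    by rewrite -ptE // addrA -(subtrD _ _ (pB g)) -uE.
  have uE' : u - (iter l t n + w1) = w0 - w1 by rewrite uE opprD addrACA subrr add0r.
  have [||u' lu' Bu'] := IHl (w0 - w1).
  - by apply: addsubB => //; apply: layer_addsub.
  - exists w => //; rewrite -uE' pB addrAC.
    by apply: addsubB => //; apply: Bp.
  exists u' => //; rewrite -uE' in Bu'.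
  by have := addsubD Bs Bn Bu'; rewrite addrA [_ + (u - _)]addrC subrK.
elim: k v => [|k IHk] v lv [w lw Bw]; first by exists w => //; rewrite expr0 pact1 in Bw.
apply: IHk => //; apply: (step i); first exact: lp.
by exists w; rewrite // -pactM // -exprS.
Qed.

(** Induction on the level.  A power of [f] moves the leading coefficient of [v]
    into [lead B j], so it moves [v] down one level, and the result is still
    divisible by every power of [g]. *)
Lemma layer_cap j v : layer j v ->
  (forall k, exists2 m, adjoin m & B (v - pact x (g ^+ k) m)) ->
  exists e, B (pact x (f ^+ e) v).
Proof.
elim: j v => [|j IHj] v.
  by move->; exists 0%N; rewrite (subtr0 (pB _)); apply: addsub0.
move=> lv capv; have [n [w [Nn lw vE]]] := lv.
have [|e [_ [w' lw' Bn]]] := (flatf j fg).2 n Nn.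
  move=> k; have [m [i lm] Bm] := capv k.
  have [|m' lm' Bm'] := @layer_descend i j.+1 k m lm.
    by exists v => //; rewrite -opprB; apply: addsubN.
  have [n' [u [Nn' lu m'E]]] := lm'.
  exists n' => //; split; first by apply: addsubB => //; apply: Np.
  exists (w - pact x (g ^+ k) u).
    by apply: addsubB => //; [exact: layer_addsub | exact: lp].
  rewrite tiB -(ptE _ _ (NC Nn')) addrACA -opprD -(subtrD _ _ (pB _)) -m'E -vE.
  have := addsubD Bs Bm (Bp (g ^+ k) Bm').
  by rewrite pB addrA subrK.
pose v' := pact x (f ^+ e) w - w'.
have v'E : v' = pact x (f ^+ e) v - (iter j t (pact x (f ^+ e) n) + w').
  rewrite /v' vE (subtrD _ _ (pB _)) (ptE _ _ (NC Nn)).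
  by rewrite opprD addrACA subrr add0r.
have [||e' Be'] := IHj v'.
- by apply: addsubB => //; [exact: layer_addsub | exact: lp].
- move=> k; have [m am Bm] := capv k; exists (pact x (f ^+ e) m).
    by apply: (opsub_pact (L := adjoin)) => //; case: adjoin_opsub => As Ao; split=> // o Oo; apply: Ao; left.
  rewrite v'E -pactM // mulrC pactM // addrAC -pB.
  by apply: addsubB => //; apply: Bp.
exists (e' + e)%N; rewrite exprD pactM //.
have -> : pact x (f ^+ e) v = v' + (iter j t (pact x (f ^+ e) n) + w').
  by rewrite v'E subrK.
by rewrite (subtrD _ _ (pB _)); apply: addsubD => //; apply: Bp.
Qed.

End Filtration.

Theorem generically_flat_adjoin : generically_flat (O `|` [set t]) adjoin.
Proof.
move=> B BO sBa; have [f nzf flatf] := flat_off_lead BO.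
exists f => // g fg; split=> [v [j lv]|v [j lv]].
  exact: layer_inj lv.
exact: layer_cap lv.
Qed.

End Generic.
End Noetherian.

End FlatnessPart.

(** * Modules over a group with a central tower *)

Section TowerPart.
Import GRing.Theory Num.Theory.
Local Open Scope ring_scope.

Section Base.
Variable V : zmodType.
Implicit Types (B N L C : set V) (O : set (V -> V)) (u v w : V) (p q f g : {poly int}).

Lemma opsubW O O' B : O `<=` O' -> opsub O' B -> opsub O B.
Proof. by move=> sO [Bs Bo]; split=> // o Oo; apply/Bo/sO. Qed.

Lemma noetherianW O O' N N' : O `<=` O' -> N' `<=` N ->
  noetherian O N -> noetherian O' N'.
Proof.
move=> sO sN noe B BO BN BS; apply: noe => // i; first exact: opsubW (BO i).
by apply: subset_trans (BN i) sN.
Qed.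

Lemma generically_flatW x nz test O O' N : O `<=` O' ->
  generically_flat x nz test O N -> generically_flat x nz test O' N.
Proof. by move=> sO gf L LO; apply: gf; apply: opsubW LO. Qed.

Variable a : V.

Definition zline : set V := [set v | exists z : int, v = a *~ z].

Lemma zline_addsub : addsub zline.
Proof.
split=> [|_ _ [z1 ->] [z2 ->]]; first by exists 0; rewrite mulr0z.
by exists (z1 - z2); rewrite mulrzBr.
Qed.

(** A nonzero subgroup of Z is generated by its least positive element, which
    already occurs at a finite stage of the chain. *)
Lemma zline_noetherian : noetherian set0 zline.
Proof.
move=> B BO BN BS; have Bs i : addsub (B i) := (BO i).1.
have Bz i : B i 0 := addsub0 (Bs i).
have Ble i j : (i <= j)%N -> B i `<=` B j by apply: chain_le.
pose P := [pred d : nat | `[< exists n, B n (a *+ d.+1) >]].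
have [exd|nod] := pselect (exists d, P d); last first.
  exists 0%N => m _ v Bv; have [z vE] := BN _ _ Bv.
  suff -> : v = 0 by apply: Bz.
  case: z vE => [[|d]|d] vE; first by rewrite vE mulr0z.
    by case: nod; exists d; apply/asboolP; exists m; rewrite pmulrn -vE.
  case: nod; exists d; apply/asboolP; exists m.
  by rewrite -[_ *+ _]opprK -[- (_ *+ _)]/(a *~ Negz d) -vE; apply: addsubN.
case: (ex_minnP exd) => d /asboolP[n Bn] dmin; exists n => m nm v Bv.
have [z vE] := BN _ _ Bv.
have zE := divz_eq z d.+1; set q := (z %/ _)%Z in zE; set r := (z %% _)%Z in zE.
have r0 : 0 <= r by apply: modz_ge0.
have rd : r < d.+1 by have := ltz_pmod z (isT : (0 : int) < d.+1).
have Br : B m (a *~ r).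
  have -> : r = z - d.+1%:Z * q by rewrite [in RHS]zE mulrC addrC addKr.
  rewrite mulrzBr mulrzA -pmulrn -vE; apply: addsubB => //.
  by apply: addsubMz => //; apply: Ble Bn.
have {Br rd r0} rE : r = 0.
  case: r r0 rd Br {zE} => // -[|k] // _ kd Bk.
  have /dmin : P k by rewrite inE; exists m; rewrite pmulrn.
  by rewrite leqNgt; move: kd; rewrite ltz_nat ltnS => ->.
by rewrite vE zE rE addr0 mulrC mulrzA -pmulrn; apply: addsubMz.
Qed.

Variables (C : set V) (x : V -> V).
Hypothesis Cs : addsub C.
Hypothesis Ca : C a.
Hypothesis xB : subtractive x.
Hypothesis Cx : forall v, C v -> C (x v).

Definition polyline : set V := [set pact x p a | p in [set: {poly int}]].

Lemma polyline_opsub : opsub [set x] polyline.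
Proof.
split=> [|_ -> _ [p _ <-]]; last by exists ('X * p); rewrite ?pactXM.
split=> [|_ _ [p _ <-] [q _ <-]]; first by exists 0; rewrite ?pact0.
by exists (p - q); rewrite ?pactB.
Qed.

Lemma polyline_base : polyline a. Proof. by exists 1; rewrite ?pact1. Qed.

Lemma polyline_sub : polyline `<=` C.
Proof. by move=> _ [p _ <-]; apply: pact_closed. Qed.

Lemma polyline_noetherian : noetherian [set x] polyline.
Proof.
have zC : zline `<=` C by move=> _ [z ->]; apply: addsubMz.
have xadj : adjoinable set0 x C zline.
  by split=> //; split=> //; apply: zline_addsub.
apply: noetherianW (noetherian_adjoin xadj zline_noetherian).
  by move=> o [].
have [As Ao] := adjoin_opsub xadj.
have Ax v : adjoin x zline v -> adjoin x zline (x v) by apply: Ao; right.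
move=> _ [p _ <-]; apply: pact_closed => //.
by apply: adjoin_sub; exists 1; rewrite mulr1z.
Qed.

Definition nonvanishing : set {poly int} := [set f | pact x f a <> 0].

(** What Krull's intersection theorem gives for a nonzero nonunit [g] of the
    domain Z[X] modulo the annihilator of [a]: no zero divisor, and no nonzero element
    divisible by all its powers. *)
Definition separated g : Prop :=
  (forall q, pact x (g * q) a = 0 -> pact x q a = 0) /\
  (forall q, (forall k, exists p, pact x (q - g ^+ k * p) a = 0) -> pact x q a = 0).

(** Comaximality of [f] and [g] is only asked on [C]: an annihilator of [C] may be
    needed in the relation. *)
Definition coprime_test f g : Prop := separated g /\
  exists s r : {poly int}, forall v, C v -> pact x (s * f + r * g) v = v.

Lemma coprime_testM f f' g :
  coprime_test (f * f') g -> coprime_test f g /\ coprime_test f' g.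
Proof.
move=> [sg [s [r srE]]]; split; split=> //.
  by exists (s * f'), r; rewrite -mulrA [f' * _]mulrC.
by exists (s * f), r; rewrite -mulrA.
Qed.

(** If some polynomial that does not vanish on [a] maps [a] into [L], it kills the
    quotient and serves as [f].  Otherwise the quotient is free of rank one over
    Z[X] modulo the annihilator of [a], and [f = 1] works. *)
Lemma polyline_flat : a <> 0 ->
  generically_flat x nonvanishing coprime_test [set x] polyline.
Proof.
move=> a0 L [Ls Lx] sL.
have Lp p v : L v -> L (pact x p v) by apply: pact_closed => // u; apply: Lx.
have [[f [nzf Lf]]|nof] := pselect (exists f, nonvanishing f /\ L (pact x f a)).
  exists f => // g [_ [s [r srE]]].
  have Lfn n : polyline n -> L (pact x f n).
    by case=> p _ <-; rewrite -pactM // mulrC pactM //; apply: Lp.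
  split=> [n Pn Ln|n Pn _]; last by exists 1%N; rewrite expr1; apply: Lfn.
  rewrite -(srE n (polyline_sub Pn)) pactD !pactM //.
  by apply: addsubD => //; apply: Lp => //; apply: Lfn.
have L0 p : L (pact x p a) -> pact x p a = 0.
  by move=> Lpa; apply: contrapT => nz; apply: nof; exists p.
exists 1; first by rewrite /nonvanishing /= pact1.
move=> g [[ginj gcap] _]; split=> [_ [p _ <-]|_ [p _ <-] capp].
  by rewrite -pactM // => /L0/ginj->; apply: addsub0.
exists 0%N; rewrite expr0 pact1 gcap; first exact: addsub0.
move=> k; have [_ [v _ <-] Lv] := capp k; exists v; apply: L0.
by rewrite pactB pactM.
Qed.

End Base.

Section Tower.
Variables (V : zmodType) (H : groupType) (act : V -> H -> V) (K0 : set H).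
Hypothesis actB : forall h, subtractive (act^~ h).
Hypothesis actM : forall v g h, act v (g * h)%g = act (act v g) h.
Hypothesis act1 : forall v, act v 1%g = v.
Hypothesis K0n : is_normal K0.
Hypothesis K0act : forall v h, K0 h -> act v h = v.
Implicit Types (u v w : V) (B : set V) (K : set H) (p q f g : {poly int}).

Definition submod B : Prop := addsub B /\ forall v h, B v -> B (act v h).

Definition cyclic_submod a : set V :=
  [set v | forall B, submod B -> B a -> B v].

Lemma cyclic_submodP a : submod (cyclic_submod a).
Proof.
split=> [|v h Rv B sB Ba]; last by apply: sB.2; apply: Rv.
split=> [B sB _|u v Ru Rv B sB Ba]; first exact: addsub0 sB.1.
by apply: addsubB sB.1 _ _; [apply: Ru | apply: Rv].
Qed.

Lemma cyclic_submod_id a : cyclic_submod a a. Proof. by move=> B. Qed.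

Lemma cyclic_submod_min a B : submod B -> B a -> cyclic_submod a `<=` B.
Proof. by move=> sB Ba v; apply. Qed.

(** Besides the action of [K], the operator [x] is kept throughout, so that stable
    subgroups are also stable under polynomials in [x]. *)
Definition ops (x : V -> V) K : set (V -> V) :=
  x |` [set act^~ k | k in K].

Lemma actK v h : act (act v h) h^-1%g = v.
Proof. by rewrite -actM mulgV act1. Qed.

Lemma actKV v h : act (act v h^-1%g) h = v.
Proof. by rewrite -actM mulVg act1. Qed.

Section Climb.
Variables (C : set V) (x : V -> V) (a : V).
Hypothesis sC : submod C.
Hypothesis Ca : C a.
Hypothesis xB : subtractive x.
Hypothesis Cx : forall v, C v -> C (x v).
Hypothesis xact : forall v h, C v -> x (act v h) = act (x v) h.

(** Climbing the tower.  At the bottom the group acts trivially and one starts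
    from Z[x] a; each generator [h] is adjoined as the operator [h] followed by
    its inverse. *)
Lemma tower_noetherian_flat K : central_tower K0 K ->
  exists N, [/\ N a, N `<=` C, opsub (ops x K) N, noetherian (ops x K) N &
    a <> 0 ->
    (forall f f', nonvanishing a x f -> nonvanishing a x f' -> nonvanishing a x (f * f')) ->
    generically_flat x (nonvanishing a x) (coprime_test a C x) (ops x K) N].
Proof.
have opsB K' o : ops x K' o -> subtractive o by move=> [->|[k _ <-]].
have opsC K' : opsub (ops x K') C.
  by split=> [|o [->|[k _ <-]] v Cv]; [exact: sC.1 | exact: Cx | apply: sC.2].
elim=> {K} [|K h twK [N [Na NC NO noeN flatN]] Kh].
  exists (polyline a x).
  have xops : [set x] `<=` ops x K0 by move=> o ->; left.
  split; [exact: polyline_base | apply: (@polyline_sub _ a C) => //; exact: sC.1 | | |].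
  - have [Ps Px] := polyline_opsub a xB; split=> // o [->|[k Kk <-]] v Pv; first exact: Px.
    by rewrite K0act.
  - by apply: noetherianW xops _ (polyline_noetherian sC.1 Ca xB Cx).
  - by move=> a0 _; apply: generically_flatW xops _; apply: polyline_flat => //; exact: sC.1.
have [sK Kj] := central_tower_normal K0n twK.
have conjl h1 k v : act (act v k) h1 = act (act v h1) (k ^ h1)%g.
  by rewrite -!actM -conjgC.
have conjr h1 k v : act (act v h1) k = act (act v (k ^ h1^-1)%g) h1.
  by rewrite -!actM -conjgCV.
have adj1 : adjoinable (ops x K) (act^~ h) C N.
  split=> //.
  - exact: opsB.
  - by move=> v; apply: sC.2.
  - move=> o [->|[k Kk <-]]; first by exists x; [left|move=> v /xact->].
    by exists (act^~ (k ^ h)%g); [right; exists (k ^ h)%g => //; apply: Kj | move=> v _; apply: conjl].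
  - move=> o [->|[k Kk <-]]; first by exists x; [left|move=> v /xact->].
    by exists (act^~ (k ^ h^-1)%g); [right; exists (k ^ h^-1)%g => //; apply: Kj | move=> v _; apply: conjr].
pose O1 := ops x K `|` [set act^~ h]; pose N1 := adjoin (act^~ h) N.
have N1O : opsub O1 N1 := adjoin_opsub adj1.
have noeN1 : noetherian O1 N1 := noetherian_adjoin adj1 noeN.
have adj2 : adjoinable O1 (act^~ h^-1%g) C N1.
  split=> //.
  - by move=> o [|->] //; apply: opsB.
  - split=> [|o [Oo|->] v Cv]; first exact: sC.1; last exact: sC.2.
    exact: (opsC K).2 Oo _ Cv.
  - by move=> v; apply: sC.2.
  - exact: adjoin_subC adj1.
  - move=> o [[->|[k Kk <-]]|->].
    + by exists x; [left; left|move=> v /xact->].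
    + exists (act^~ (k ^ h^-1)%g); last by move=> v _; apply: conjl.
      by left; right; exists (k ^ h^-1)%g => //; apply: Kj.
    + by exists (act^~ h); [right|move=> v _; rewrite actK actKV].
  - move=> o [[->|[k Kk <-]]|->].
    + by exists x; [left; left|move=> v /xact->].
    + exists (act^~ (k ^ h)%g); last by move=> v _; rewrite conjr invgK.
      by left; right; exists (k ^ h)%g => //; apply: Kj.
    + by exists (act^~ h); [right|move=> v _; rewrite actK actKV].
pose O2 := O1 `|` [set act^~ h^-1%g]; pose N2 := adjoin (act^~ h^-1%g) N1.
have N2O : opsub O2 N2 := adjoin_opsub adj2.
have sO2 : O2 `<=` ops x (generated (K `|` [set h])).
  have sg := generated_subgroup (K `|` [set h]).
  have gh : generated (K `|` [set h]) h by apply: sub_generated; right.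
  move=> o [[[->|[k Kk <-]]|->]|->]; first by left.
  - by right; exists k => //; apply: sub_generated; left.
  - by right; exists h.
  - by right; exists h^-1%g => //; apply: (subgroupV sg).
exists N2; split.
- by do 2!apply: adjoin_sub.
- exact: adjoin_subC adj2.
- split=> [|o]; first exact: N2O.1.
  case=> [->|[k gk <-]] v N2v; first by apply: N2O.2 => //; do 3!left.
  pose S : set H := [set k | (forall v, N2 v -> N2 (act v k)) /\
                            (forall v, N2 v -> N2 (act v k^-1%g))].
  suff /(_ k gk)[Sk _] : generated (K `|` [set h]) `<=` S by apply: Sk.
  apply: generated_sub.
    split=> [|k1 k2 [S1 S1'] [S2 S2']|k1 [S1 S1']] ; rewrite ?/S /=.
    + by split=> w; rewrite ?invg1 act1.
    + by split=> w Nw; rewrite ?invgM actM; [apply/S2/S1 | apply/S1'/S2'].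
    + by split=> w; [exact: S1' | rewrite invgK; exact: S1].
  have N2K k1 w : K k1 -> N2 w -> N2 (act w k1).
    by move=> Kk1; apply: (N2O.2 (act^~ k1)); left; left; right; exists k1.
  move=> k1 [Kk1|->]; split=> w Nw.
  + exact: N2K.
  + by apply: N2K => //; apply: subgroupV.
  + by apply: (N2O.2 (act^~ h)) => //; left; right.
  + by apply: (N2O.2 (act^~ h^-1%g)) => //; right.
- by apply: noetherianW sO2 _ (noetherian_adjoin adj2 noeN1).
- move=> a0 nzM; apply: generically_flatW sO2 _.
  have Ox : ops x K x by left.
  have flat1 := generically_flat_adjoin adj1 Ox _ nzM (@coprime_testM _ a C x) noeN (flatN a0 nzM).
  apply: (generically_flat_adjoin adj2 _ _ nzM (@coprime_testM _ a C x) noeN1).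
  + by left.
  + by move=> v Cv; rewrite xact.
  + by apply: flat1 => v Cv; rewrite xact.
Qed.

End Climb.

Hypothesis towerT : central_tower K0 [set: H].

Lemma cyclic_noetherian a (B : nat -> set V) :
  (forall i, submod (B i)) -> (forall i, B i `<=` cyclic_submod a) ->
  (forall i, B i `<=` B i.+1) -> exists n, forall m, (n <= m)%N -> B m `<=` B n.
Proof.
move=> sB; pose x : V -> V := fun=> 0.
(* The chain condition for the zero operator is the one for the group alone. *)
have xB : subtractive x by move=> u v; rewrite subr0.
have [||||N [Na _ NO noeN _]] := @tower_noetherian_flat setT x a _ _ xB _ _ _ towerT => //.
  by move=> v h _; rewrite (subtr0 (actB h)).
move=> Ba; apply: noeN => i; last first.
  apply: subset_trans (Ba i) (cyclic_submod_min _ Na).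
  split=> [|v h]; first exact: NO.1.
  by apply: (NO.2 (act^~ h)); right; exists h.
have [Bs Bh] := sB i; split=> // o [->|[h _ <-]] v Bv; first exact: addsub0.
exact: Bh.
Qed.

End Tower.

End TowerPart.

(** * Modules with a just-non-nilpotent cyclic submodule *)

Section CorePart.
Import GRing.Theory Num.Theory.
Local Open Scope ring_scope.

Lemma pact_zero (V : zmodType) (p : {poly int}) (v : V) :
  pact (fun=> 0) p v = v *~ p`_0.
Proof.
rewrite (@pactE _ _ (size p).+1) // big_ord_recl /= big1 ?addr0 // => i _.
by rewrite mul0rz.
Qed.

Section Core.
Variables (V : zmodType) (H : groupType) (act : V -> H -> V) (K0 : set H).
Hypothesis actB : forall h, subtractive (act^~ h).
Hypothesis actM : forall v g h, act v (g * h)%g = act (act v g) h.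
Hypothesis act1 : forall v, act v 1%g = v.
Hypothesis K0n : is_normal K0.
Hypothesis K0act : forall v h, K0 h -> act v h = v.
Hypothesis towerT : central_tower K0 [set: H].
Implicit Types (u v w m : V) (B D : set V) (K : set H) (p q f g : {poly int}).
Local Notation submod := (submod act).

(** The module analogue of [ucs]: [ucsV B k] consists of the [v] with I^k v in
    [B], for [I] the augmentation ideal. *)
Fixpoint ucsV B (k : nat) : set V :=
  if k is k'.+1 then [set v | forall h, ucsV B k' (act v h - v)] else B.

Lemma ucsV_submod B k : submod B -> submod (ucsV B k).
Proof.
move=> sB; elim: k => //= k [Us Uh]; split.
  split=> [h|u v Uu Uv h] /=; first by rewrite (subtr0 (actB h)) subrr; apply: addsub0.
  have -> : act (u - v) h - (u - v) = (act u h - u) - (act v h - v).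
    by rewrite actB !opprD !opprK addrACA.
  exact: addsubB.
move=> v g Uv h /=.
have -> : act (act v g) h - act v g = act (act v (g * h * g^-1)%g - v) g.
  by rewrite actB -!actM mulgVK.
exact/Uh/Uv.
Qed.

Lemma ucsV_mono B D k : B `<=` D -> ucsV B k `<=` ucsV D k.
Proof. by move=> sB; elim: k => //= k IHk v Uv h; apply/IHk/Uv. Qed.

Lemma ucsV_add B j k : ucsV B (j + k) = ucsV (ucsV B j) k.
Proof. by elim: k => [|k IHk] /=; rewrite ?addn0 // addnS /= IHk. Qed.

Variable a : V.
Hypothesis aU : forall k, ~ ucsV [set 0] k a.
Hypothesis aB : forall B, submod B -> (exists2 v, B v & v <> 0) ->
  exists k, ucsV B k a.

Let C := cyclic_submod act a.
Let sC : submod C := cyclic_submodP act a.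
Let Cs : addsub C := sC.1.
Let Ca : C a := @cyclic_submod_id _ _ act a.
Let Cact v h : C v -> C (act v h). Proof. exact: sC.2. Qed.
Let Cmin D : submod D -> D a -> C `<=` D := @cyclic_submod_min _ _ act a D.

Let a0 : a <> 0. Proof. exact: (aU (k := 0%N)). Qed.

Definition endo_on (W : set V) (phi : V -> V) : Prop :=
  [/\ subtractive phi, forall v, W v -> W (phi v) &
      forall v h, W v -> phi (act v h) = act (phi v) h].

Lemma endo_ker W phi : submod W -> endo_on W phi ->
  submod [set v | W v /\ phi v = 0].
Proof.
move=> [Ws Wh] [phB _ pha]; split.
  split=> [|u v [Wu pu] [Wv pv]]; first by split; [exact: addsub0 | exact: subtr0].
  by split; [exact: addsubB | rewrite phB pu pv subrr].
by move=> v h [Wv pv]; split; [exact: Wh | rewrite pha // pv (subtr0 (actB h))].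
Qed.

Lemma endo_im W D phi : submod D -> D `<=` W -> endo_on W phi ->
  submod [set phi v | v in D].
Proof.
move=> [Ds Dh] DW [phB _ pha]; split.
  split=> [|_ _ [u Du <-] [v Dv <-]]; first by exists 0; [exact: addsub0 | exact: subtr0].
  by exists (u - v); [exact: addsubB | rewrite phB].
by move=> _ h [v Dv <-]; exists (act v h); [exact: Dh | rewrite pha //; apply: DW].
Qed.

Lemma endo_eq0 phi : endo_on C phi -> phi a = 0 -> forall v, C v -> phi v = 0.
Proof.
move=> Ephi pa v Cv.
by have [] := Cmin (endo_ker sC Ephi) (conj Ca pa) Cv.
Qed.

(** If [phi] had a nonzero kernel on [C], then I^k a would lie in that kernel for
    some [k], hence I^k would kill the image of [phi].  As the image is nonzero, it
    contains I^l a for some [l], so I^(k+l) would kill [a]. *)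
Lemma endo_inj phi : endo_on C phi -> phi a <> 0 ->
  forall v, C v -> phi v = 0 -> v = 0.
Proof.
move=> Ephi pa v Cv pv; have [phB Cph pha] := Ephi.
apply: contrapT => v0.
have [k Uka] : exists k, ucsV [set v | C v /\ phi v = 0] k a.
  by apply: aB; [exact: endo_ker | exists v].
have [l Ula] : exists l, ucsV [set phi v | v in C] l a.
  by apply: aB; [apply: (endo_im (W := C)) | exists (phi a) => //; exists a].
apply: (@aU (k + l)); rewrite ucsV_add; apply: ucsV_mono Ula => _ [w Cw <-].
have : ucsV [set v | C v /\ phi v = 0] k w.
  by apply: (Cmin _ Uka) => //; apply/ucsV_submod/endo_ker.
elim: k w Cw {Uka} => [|k IHk] w Cw /=; first by case.
move=> Uw h; rewrite -pha // -phB; apply: IHk => //.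
by apply: (addsubB Cs) => //; apply: Cact.
Qed.

Lemma pact_endo W x p : submod W -> endo_on W x -> endo_on W (pact x p).
Proof.
move=> sW [xB Wx xa]; split; first exact: pact_subtractive.
  by move=> v; apply: pact_closed => //; exact: sW.1.
move=> v h Wv; rewrite -(pact_comm p (actB h) Wx _ Wv) // => u Wu.
by rewrite xa.
Qed.

Lemma pact_eq0 x p v : endo_on C x -> pact x p a = 0 -> C v -> pact x p v = 0.
Proof. by move=> Ex pa; apply: endo_eq0 => //; apply: pact_endo. Qed.

Definition onto_C (phi : V -> V) : Prop := forall v, C v -> exists2 w, C w & phi w = v.

(** Generic flatness applied to the zero submodule of [C]: a surjective [g] makes
    [a] divisible by all its powers, so a power of [f] would kill [a], while
    the polynomials that do not kill [a] are closed under products. *)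
Lemma generic_not_onto x : endo_on C x ->
  exists2 f, pact x f a <> 0 &
    forall g, separated a x g ->
      (exists s r : {poly int}, forall v, C v -> pact x (s * f + r * g) v = v) ->
      ~ onto_C (pact x g).
Proof.
move=> Ex; have [xB Cx xa] := Ex.
have [N [Na NC NO _ gfN]] := tower_noetherian_flat actB actM act1 K0n K0act
  sC Ca xB Cx xa towerT.
have nzM f f' : nonvanishing a x f -> nonvanishing a x f' -> nonvanishing a x (f * f').
  move=> nzf nzf'; rewrite /nonvanishing /= pactM // => e; apply: nzf'.
  by apply: (endo_inj (pact_endo f sC Ex) nzf _ e); exact: pact_closed Cs Cx Ca.
have [||f nzf flatf] := gfN a0 nzM [set 0].
- split=> [|o [->|[h _ <-]] v ->]; first exact: addsub_zero.
    exact: subtr0.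
  exact: subtr0 (actB h).
- by move=> v ->; apply: addsub0 NO.1.
exists f => // g sepg cop onto.
have CN : C `<=` N.
  apply: Cmin Na; split; first exact: NO.1.
  by move=> v h; apply: (NO.2 (act^~ h)); right; exists h.
have [_ cap] := flatf g (conj sepg cop).
have [|e] := cap a Na.
  elim=> [|k [w Nw aw]]; first by exists a; rewrite // expr0 pact1 subrr.
  have [u Cu uw] := onto w (NC _ Nw); exists u; first exact: CN.
  by rewrite exprSr pactM // uw.
suff : nonvanishing a x (f ^+ e) by [].
by elim: e => [|e IHe]; rewrite ?exprS; [rewrite /nonvanishing /= pact1 | apply: nzM].
Qed.

Section Central.
Variable z : H.
Hypothesis zC : forall v h, C v -> act v [~ z, h]%g = v.
Hypothesis za : act a z <> a.
Let x v := act v z - v.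

Let xB : subtractive x.
Proof. by move=> u v; rewrite /x actB !opprD !opprK addrACA. Qed.

Let Ex : endo_on C x.
Proof.
split=> //; first by move=> v Cv; apply: (addsubB Cs) => //; apply: Cact.
move=> v h Cv; rewrite /x actB; congr (_ - _).
by rewrite -!actM [(z * h)%g]commgC [RHS]actM zC // actM; do 2!apply: Cact.
Qed.
Let Cx : forall v, C v -> C (x v). Proof. by case: Ex. Qed.

Let xa0 : x a <> 0. Proof. by move/eqP; rewrite subr_eq0 => /eqP. Qed.

Lemma iter_ucsV D k v : ucsV D k v -> D (iter k x v).
Proof. by elim: k v => // k IHk v Uv; rewrite iterSr; apply/IHk/Uv. Qed.

(** The image [D] of [1 + X q] is a nonzero submodule, so it contains x^k a for
    some [k]; since X^k and [1 + X q] are comaximal, it contains [a]. *)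
Lemma unit_onto q : pact x (1 + 'X * q) a <> 0 -> onto_C (pact x (1 + 'X * q)).
Proof.
set F := 1 + _ => Fa; pose D := [set pact x F v | v in C].
have sD : submod D by apply: endo_im sC _ (pact_endo F sC Ex).
have Dp p v : D v -> D (pact x p v).
  by case=> w Cw <-; exists (pact x p w); [exact: pact_closed Cs Cx Cw | rewrite -!pactM // mulrC].
(* X^k is comaximal with F because (- X q)^k = 1 modulo F. *)
have [k /iter_ucsV Dk] : exists k, ucsV D k a.
  by apply: aB => //; exists (pact x F a) => //; exists a.
suff Da : D a by move=> v Cv; apply: Cmin Da v Cv.
have : D (pact x (1 - (- ('X * q)) ^+ k) a).
  have -> : 1 - (- ('X * q)) ^+ k = (\sum_(i < k) (- ('X * q)) ^+ i) * F.
    rewrite -opprB subrX1 -mulNr opprB opprK mulrC.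
    by congr (_ * _); rewrite addrC.
  by rewrite pactM //; apply: Dp; exists a.
rewrite pactB pact1; apply: contraPP => nDa; apply: contra_not nDa => Da'.
have Dq : D (pact x ((- ('X * q)) ^+ k) a).
  rewrite -mulrN mulrC exprMn pactM //; apply: Dp.
  rewrite pact_exp //; suff -> : iter k (pact x 'X) a = iter k x a by [].
  by apply: eq_iter => v; rewrite pactX.
by have := addsubD sD.1 Da' Dq; rewrite subrK.
Qed.


Section Contra.
Hypothesis unitS : forall q, pact x (1 + 'X * q) a <> 0.

(** If the annihilator of [a] is the kernel of reduction of Z[X] to R0[X], the
    polynomial [1 + X f] becomes a nonzero nonunit comaximal with [f], yet it acts
    surjectively on [C]. *)
Lemma not_transcendental (R0 : idomainType) :
  ~ (forall h, pact x h a = 0 <-> map_poly (intr : int -> R0) h = 0).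
Proof.
move=> aE; have [f nzf fP] := generic_not_onto Ex.
pose pi (p : {poly int}) : {poly R0} := map_poly (intr : int -> R0) p.
have pif : pi f != 0 by apply/eqP => /aE.
pose g := 1 + 'X * f.
have piX p : pi ('X * p) = 'X * pi p by rewrite /pi rmorphM /= map_polyX.
have pig : pi g = 1 + 'X * pi f by rewrite -piX /pi rmorphD rmorph1.
have sg : (1 < size (pi g))%N.
  by rewrite pig addrC mulrC size_MXaddC (negPf pif) /= ltnS size_poly_gt0.
have g0 : pi g != 0 by rewrite -size_poly_gt0 ltnW.
apply: (fP g) => //; last 2 first.
- exists (- 'X), 1 => v Cv; rewrite /g mul1r mulNr addrC addrK; exact: pact1.
- exact: unit_onto.
split=> [q /aE/eqP|q qP].
  by rewrite rmorphM mulf_eq0 (negPf g0) => /eqP/aE.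
apply/aE/eqP; apply: contraT => q0.
have [p /aE pE] := qP (size (pi q)).
have qE : pi q = pi g ^+ size (pi q) * pi p.
  by apply/eqP; rewrite -subr_eq0 -rmorphXn -rmorphM -rmorphB; apply/eqP.
have p0 : pi p != 0 by apply: contraNneq q0 => p0; rewrite -/(pi q) qE p0 mulr0.
have sq : size (pi q) = size (pi g ^+ size (pi q) * pi p) by rewrite -qE.
suff : (size (pi q) < size (pi q))%N by rewrite ltnn.
have sgq : (size (pi q) < size (pi g ^+ size (pi q)))%N.
  have := size_exp (pi g) (size (pi q)).
  have := expf_neq0 (size (pi q)) g0; rewrite -size_poly_gt0.
  case: (size (pi g ^+ size (pi q))) => // k _ /= ->; rewrite ltnS leq_pmull //.
  by case: (size (pi g)) sg => [|[|]].
rewrite {2}sq size_mul ?expf_neq0 //.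
move: p0; rewrite -size_poly_gt0; case: (size (pi p)) => // k _.
by rewrite addnS /=; apply: leq_trans sgq (leq_addr _ _).
Qed.


(** Constants that vanish in [R0] kill [a], and [x] is injective on [C], so the
    powers of X can be divided out of an annihilating polynomial. *)
Lemma annihilator_const (R0 : idomainType) h :
  (forall c : int, c%:~R = 0 :> R0 -> a *~ c = 0) ->
  pact x h a = 0 -> map_poly (intr : int -> R0) h <> 0 ->
  exists c q, c%:~R <> 0 :> R0 /\ pact x (c%:P + 'X * q) a = 0.
Proof.
move=> char; elim/poly_ind: h => [_ []|h c IHh ha h0]; first by rewrite rmorph0.
have [c0|c0] := pselect (c%:~R = 0 :> R0); last by exists c, h; rewrite mulrC addrC.
apply: IHh; last first.
  by move=> h1; apply: h0; rewrite rmorphD rmorphM /= h1 mul0r add0r map_polyC /= c0.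
apply: (endo_inj Ex xa0); first exact: pact_closed Cs Cx Ca.
by rewrite -pactXM // mulrC; move: ha; rewrite pactD pactC (char _ c0) addr0.
Qed.

Lemma mulrz_endo n : endo_on C (fun v => v *~ n).
Proof.
split=> [u v|v Cv|v h _]; [exact: mulrzBl | exact: (addsubMz _ Cs Cv) |].
by rewrite (subtrMz _ _ (actB h)).
Qed.

Lemma torsion_free : (forall n, prime n -> a *+ n <> 0) ->
  forall n : int, n != 0 -> a *~ n <> 0.
Proof.
move=> tf n n0; wlog [k ->] : n n0 / exists k : nat, n = k.+1%:Z.
  move=> th; case: n n0 => [[|k]|k] // n0; first by apply: th => //; exists k.
  move=> an; apply: (th k.+1) => //; first by exists k.
  by rewrite -[k.+1%:Z]opprK -NegzE mulrNz an oppr0.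
rewrite -pmulrn => {n n0}; elim/ltn_ind: k => k IHk.
case: k IHk => [|k] IHk; first by rewrite mulr1n.
have pp : prime (pdiv k.+2) by apply: pdiv_prime.
have /dvdnP[m mE] := pdiv_dvd k.+2.
have m0 : (0 < m)%N by case: m mE.
have mk : (m.-1 < k.+1)%N.
  rewrite -ltnS prednK // mE ltn_Pmulr //; exact: prime_gt1.
move=> ak; apply: (IHk _ mk); rewrite prednK //.
apply: (endo_inj (mulrz_endo (pdiv k.+2)%:Z)).
- by rewrite -pmulrn; apply: tf.
- exact: (addsubMn _ Cs Ca).
- by rewrite -pmulrn -mulrnA -mE.
Qed.

(** A relation with constant term [c] makes [c] act as a multiple of [x] on [C].
    Hence the integer 1 + (c d)^2 acts as a polynomial of the form 1 + X r, that
    is, surjectively, for whatever integer [d] generic flatness provides.  Here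
    generic flatness is used with X acting as zero, that is, over Z. *)
Lemma not_char0_algebraic c q : (forall n : int, n != 0 -> a *~ n <> 0) ->
  c != 0 -> pact x (c%:P + 'X * q) a = 0 -> False.
Proof.
move=> tf c0 aq; pose y : V -> V := fun=> 0.
have Ey : endo_on C y.
  split=> [u v|v _|v h _]; [by rewrite subr0 | exact: addsub0 |].
  by rewrite /y (subtr0 (actB h)).
have [f nzf fP] := generic_not_onto Ey.
rewrite pact_zero in nzf; set d := f`_0 in nzf.
have d0 : d != 0 by apply/eqP => d0; apply: nzf; rewrite d0 mulr0z.
have aE n : a *~ n = 0 -> n = 0.
  by move=> an; apply/eqP; apply: contraT => /tf.
pose N : int := (c * d) ^+ 2.
have N0 : 0 < N by rewrite exprn_even_gt0 //= mulf_neq0.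
apply: (fP (1 + N)%:P).
- split=> [p|p pP]; rewrite !pact_zero.
    move/aE; rewrite coefCM => /eqP; rewrite mulf_eq0 => /orP[/eqP N1|/eqP->]; last by rewrite mulr0z.
    by move: N0; rewrite -(ltrD2l 1) addr0 N1 ltr10.
  have {}pP k : exists r, p`_0 = (1 + N) ^+ k * r.
    have [r] := pP k; rewrite pact_zero => /aE.
    by rewrite coefB -polyC_exp coefCM => /subr0_eq ->; exists r`_0.
  (* A nonzero integer is not divisible by the power of 1 + N whose exponent is
     its own absolute value. *)
  pose e := absz p`_0; have [r pE] := pP e.
  have [->|p0] := eqVneq p`_0 0; first by rewrite mulr0z.
  have r0 : r != 0 by apply: contraNneq p0 => r0; rewrite pE r0 mulr0.
  suff : (e < e)%N by rewrite ltnn.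
  rewrite {2}/e pE abszM abszX.
  apply: (@leq_trans (absz (1 + N) ^ e)); last by rewrite leq_pmulr // absz_gt0.
  by apply: ltn_expl; case: (N) N0 => // -[|n].
- exists (- (c ^+ 2 * d)%:P), 1 => v _; rewrite pact_zero coefD mul1r mulNr coefN coefCM -/d coefC /=.
  by rewrite (_ : - _ + _ = 1) ?mulr1z // /N; ring.
(* On C the constant c acts as - X q, so 1 + (c d)^2 acts as 1 + X r. *)
move=> v Cv; pose r := - (q * (c * d ^+ 2)%:P).
have [w Cw wv] := unit_onto (@unitS r) Cv.
exists w => //; rewrite -wv pact_zero coefC /=.
have := pact_eq0 Ex aq Cw; rewrite pactD pactC => /eqP.
rewrite addrC addr_eq0 => /eqP qw.
rewrite pactD pact1 mulrzDr mulr1z; congr (_ + _).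
rewrite (_ : 'X * r = (- (c * d ^+ 2))%:P * ('X * q)); last first.
  by rewrite /r polyCN; ring.
rewrite pactCM qw mulNrz mulrNz opprK -mulrzA; congr (_ *~ _).
by rewrite /N; ring.
Qed.

End Contra.

(** Otherwise all [1 + X q] act bijectively on [C].  Either a prime [p] kills [a]
    or [C] is torsion-free.  A relation for [x] over 'F_p could be scaled to one
    of the form 1 + X q, and a relation over Z is excluded by
    [not_char0_algebraic]; so [x] satisfies none, against [not_transcendental]. *)
Theorem central_annihilator : exists q, pact x (1 + 'X * q) a = 0.
Proof.
apply: contrapT => noq.
have unitS q : pact x (1 + 'X * q) a <> 0 by move=> qa; apply: noq; exists q.
have polyE (R0 : idomainType) : (forall c : int, c%:~R = 0 :> R0 -> a *~ c = 0) ->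
    (forall c q, c%:~R <> 0 :> R0 -> pact x (c%:P + 'X * q) a = 0 -> False) -> False.
  move=> char nalg; apply: (@not_transcendental unitS R0) => h; split=> h0.
    apply: contrapT => /(annihilator_const char h0)[c [q [c0 aq]]].
    exact: nalg aq.
  elim/poly_ind: h h0 => [|h c IHh]; first by rewrite pact0.
  rewrite rmorphD rmorphM /= map_polyX map_polyC /= => e0.
  have c0 : c%:~R = 0 :> R0.
    by have := congr1 (coefp 0%N) e0; rewrite /= coefD coefMX coefC coef0 add0r.
  rewrite pactD pactC (char _ c0) addr0 mulrC pactXM // IHh ?(subtr0 xB) //.
  by apply/eqP; move/eqP: e0; rewrite c0 addr0 mulf_eq0 polyX_eq0 orbF.
have [[p [pp ap]]|tf] := pselect (exists p : nat, prime p /\ a *+ p = 0); last first.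
  have tfree : forall n : int, n != 0 -> a *~ n <> 0.
    by apply: torsion_free => p pp ap; apply: tf; exists p.
  apply: (polyE int) => [c|c q]; rewrite intz => c0; first by rewrite c0 mulr0z.
  by move=> aq; apply: (not_char0_algebraic unitS tfree _ aq); apply/eqP.
have charp : p \in [pchar 'F_p] by apply: pchar_Fp.
have char c : c%:~R = 0 :> 'F_p -> a *~ c = 0.
  move/eqP; rewrite -(dvdz_pcharf charp) => /dvdzP[d ->].
  by rewrite mulrC mulrzA -pmulrn ap mul0rz.
apply: (polyE _ char) => c q c0 aq.
(* Divide the relation by its constant term modulo p: the error is a multiple of
   p and kills a. *)
have [b bE] : exists b : int, (b * c - 1)%:~R = 0 :> 'F_p.
  exists (nat_of_ord (c%:~R^-1 : 'F_p)); rewrite rmorphB rmorphM /= -pmulrn.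
  rewrite natr_Zp mulVf ?subrr //; exact/eqP.
apply: (unitS (b%:P * q)).
have -> : 1 + 'X * (b%:P * q) = b%:P * (c%:P + 'X * q) - (b * c - 1)%:P.
  by rewrite polyCB polyCM; ring.
by rewrite pactB pactCM pactC aq (char _ bE) mul0rz subrr.
Qed.

(** The relation found above gives a = (- x q(x))^k a, and x^k a lies in any
    nonzero submodule for large [k]. *)
Lemma central_socle B : submod B -> (exists2 v, B v & v <> 0) -> B a.
Proof.
move=> sB nzB; have [q qa] := central_annihilator.
have [k /iter_ucsV Bk] := aB sB nzB.
have Bx v : B v -> B (x v).
  by move=> Bv; apply: (addsubB sB.1) => //; apply: sB.2.
have aE : pact x (- ('X * q)) a = a.
  by apply/eqP; rewrite pactN eq_sym -addr_eq0 -{1}[a](pact1 x) -pactD qa.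
have -> : a = pact x ((- ('X * q)) ^+ k) a.
  by rewrite pact_exp //; elim: k {Bk} => //= k <-.
rewrite -mulrN mulrC exprMn pactM //; apply: pact_closed sB.1 Bx _.
by rewrite pact_exp // (eq_iter (pactX xB)).
Qed.

End Central.

(** [augm m] is I m, for [I] the augmentation ideal: the additive group generated
    by the differences [act m h - m], which is a submodule. *)
Definition augm m : set V :=
  [set v | forall B, addsub B -> (forall h, B (act m h - m)) -> B v].

Lemma augm_addsub m : addsub (augm m).
Proof.
split=> [B Bs _|u v Ru Rv B Bs Bm]; first exact: addsub0.
by apply: addsubB => //; [apply: Ru | apply: Rv].
Qed.

Lemma augm_mem m h : augm m (act m h - m). Proof. by move=> B _. Qed.

Lemma augm_submod m : submod (augm m).
Proof.
have Rs := augm_addsub m; split=> // v g Rv.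
suff : [set v | augm m (act v g)] v by [].
apply: Rv => [|h] /=.
  split=> [|u w Ru Rw] /=; first by rewrite (subtr0 (actB g)); apply: addsub0.
  by rewrite actB; apply: (addsubB Rs).
have -> : act (act m h - m) g = (act m (h * g)%g - m) - (act m g - m).
  by rewrite actB -actM opprB addrA subrK.
by apply: (addsubB Rs) => //; apply: augm_mem.
Qed.

Lemma augm_sub m B : submod B -> B m -> augm m `<=` B.
Proof.
move=> sB Bm v; apply=> [|h]; first exact: sB.1.
by apply: (addsubB sB.1) => //; apply: sB.2.
Qed.

(** The condition m = i m for some [i] in the augmentation ideal; unlike the
    equality V = I V it passes to submodules and extensions. *)
Definition perfect_at m : Prop := augm m m.

(** If m - w = i' (m - w) with w = i m, then (1 - i') (1 - i) m = 0. *)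
Lemma perfect_atP m w : augm m w -> perfect_at (m - w) -> perfect_at m.
Proof.
move=> Rw pmw; have Rs := augm_addsub m; have sR := augm_submod m.
suff Rmw : augm m (m - w) by have := addsubD Rs Rmw Rw; rewrite subrK.
apply: pmw => // h.
have -> : act (m - w) h - (m - w) = (act m h - m) - (act w h - w).
  by rewrite actB !opprD !opprK addrACA.
by apply: (addsubB Rs); [exact: augm_mem | apply: (addsubB Rs) => //; apply: sR.2].
Qed.

(** Induction on the least [n] with [phi^n v = 0].  As [phi v] lies in
    I (phi v) = phi (I v), there is [w] in I v with [phi v = phi w], and
    [v - w] lies in the kernel. *)
Lemma perfect_by_kernel W phi : submod W -> endo_on W phi ->
  (forall v, W v -> phi v = 0 -> perfect_at v) ->
  (forall v, W v -> exists n, iter n phi v = 0) ->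
  forall v, W v -> perfect_at v.
Proof.
move=> sW [phB Wph pha] perf0 nilp v Wv; have [n] := nilp v Wv.
elim: n => [|n IHn] /= in v Wv *; first by move=> v0; apply: perf0; rewrite // v0 (subtr0 phB).
rewrite -iterS iterSr => /(IHn _ (Wph _ Wv)) perf.
have [w Rw phw] : [set phi w | w in augm v] (phi v).
  apply: perf => [|h]; last first.
    exists (act v h - v); first exact: augm_mem.
    by rewrite phB pha.
  split=> [|_ _ [u1 Ru1 <-] [u2 Ru2 <-]].
    by exists 0; [exact: addsub0 (augm_addsub v) | exact: subtr0].
  by exists (u1 - u2); [exact: addsubB (augm_addsub v) _ _ | rewrite phB].
apply: (perfect_atP Rw); apply: perf0; last by rewrite phB phw subrr.
by apply: (addsubB sW.1) => //; apply: (augm_sub sW Wv).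
Qed.

Section Socle.
Hypothesis socle : forall B, submod B -> (exists2 v, B v & v <> 0) -> B a.

(** Fitting's lemma on the noetherian module generated by [v]: for large [n] the
    kernel and the image of [phi^n] meet trivially.  The kernel contains [a] as
    soon as the image does, and the image contains [a] unless it vanishes. *)
Lemma locally_nilpotent W phi : submod W -> endo_on W phi -> phi a = 0 ->
  forall v, W v -> exists n, iter n phi v = 0.
Proof.
move=> sW Ephi pa v Wv; have [phB Wph pha] := Ephi.
have sR := cyclic_submodP act v.
have RW : cyclic_submod act v `<=` W by apply: cyclic_submod_min.
have iB n : subtractive (iter n phi) by apply: subtr_iter.
have Ei n : endo_on W (iter n phi).
  elim: n => // n [_ Wi ia]; split; [exact: iB| by move=> u Wu; apply/Wph/Wi |].
  by move=> u h Wu /=; rewrite ia // pha //; apply: Wi.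
pose B n := [set u | cyclic_submod act v u /\ iter n phi u = 0].
have sB n : submod (B n).
  have [Ks Kh] := endo_ker sW (Ei n); have [Rs Rh] := sR; split.
    split=> [|u w [Ru iu] [Rw iw]]; first by split; [exact: (addsub0 Rs) | exact: subtr0].
    by split; [exact: (addsubB Rs) | rewrite iB iu iw subrr].
  move=> u h [Ru iu]; split; first exact: Rh.
  by have [] := Kh u h (conj (RW _ Ru) iu).
have [||n nP] := cyclic_noetherian actB actM act1 K0n K0act towerT sB (a := v).
- by move=> n u [].
- by move=> n u [Ru iu]; split; rewrite //= iu (subtr0 phB).
exists n; apply: contrapT => iv.
have [u Ru ua] : [set iter n phi u | u in cyclic_submod act v] a.
  apply: socle; first exact: endo_im RW (Ei n).
  by exists (iter n phi v) => //; exists v => //; apply: cyclic_submod_id.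
have [_] : B n u by apply: (nP n.+1) => //; split; rewrite //= ua.
by rewrite ua.
Qed.

End Socle.

Definition fixed K : set V := [set v | forall h, K h -> act v h = v].

Lemma fixed_submod K : is_normal K -> submod (fixed K).
Proof.
move=> [sK Kj]; split.
  split=> [h _|u v Fu Fv h Kh]; first exact: subtr0 (actB h).
  by rewrite actB Fu // Fv.
move=> v g Fv h Kh; rewrite -actM conjgCV actM Fv //; exact: Kj.
Qed.

Lemma fixed_gen K h v : (forall k, K k -> act v k = v) -> act v h = v ->
  forall k, generated (K `|` [set h]) k -> act v k = v.
Proof.
move=> Kv hv; apply: generated_sub; last by move=> k [/Kv|->].
split=> [|k1 k2 /= e1 e2|k /= e]; [exact: act1 | by rewrite actM e1 |].
by rewrite -[v in LHS]e -actM mulgV act1.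
Qed.

(** Modulo [K], which acts trivially on its fixed points, [z] is central. *)
Lemma tower_endo K (z : H) : is_normal K -> (forall h, K [~ z, h]%g) ->
  endo_on (fixed K) (fun v => act v z - v).
Proof.
move=> nK Kz; have [Fs Fh] := fixed_submod nK; split.
- by move=> u v; rewrite actB !opprD !opprK addrACA.
- by move=> v Fv; apply: (addsubB Fs) => //; apply: Fh.
move=> v h Fv; rewrite actB; congr (_ - _).
by rewrite -!actM [(z * h)%g]commgC [RHS]actM (Fh v (h * z)%g Fv).
Qed.

(** On the fixed points of [K] the operator [h - 1] kills [a], so it is locally
    nilpotent; its kernel is the set of fixed points of the next term of the
    tower. *)
Lemma perfect_descend K : central_tower K0 K ->
  (forall B, submod B -> (exists2 v, B v & v <> 0) -> B a) ->
  fixed K a -> (forall v, fixed K v -> perfect_at v) -> forall v, perfect_at v.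
Proof.
move=> twK socle; elim: K / twK => [_ perf v|K h twK IHK Kh Fa perf].
  by apply: perf => h Kh; apply: K0act.
have nK := central_tower_normal K0n twK.
have FKa : fixed K a by move=> k Kk; apply: Fa; apply: sub_generated; left.
apply: IHK => //; apply: perfect_by_kernel (fixed_submod nK) (tower_endo nK Kh) _ _.
  move=> v Fv /subr0_eq vh; apply: perf; exact: fixed_gen.
apply: locally_nilpotent => //; [exact: fixed_submod | exact: tower_endo |].
by rewrite Fa ?subrr //; apply: sub_generated; right.
Qed.

(** At the first step of the tower that moves [a], the new generator [z] acts on
    the fixed points of [K] by an endomorphism.  There [1 + X q] annihilates [a],
    hence is locally nilpotent, and its kernel is perfect because
    v = - x q(x) v holds on it. *)
Lemma perfect_or_fixed K : central_tower K0 K ->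
  fixed K a \/ (forall v, perfect_at v) /\
    forall B, submod B -> (exists2 v, B v & v <> 0) -> B a.
Proof.
elim=> [|{}K z twK [Fa|] Kz]; [by left=> h; apply: K0act | | by right].
have nK := central_tower_normal K0n twK.
have sF := fixed_submod nK.
have [za|za] := pselect (act a z = a); [by left; apply: fixed_gen | right].
have CF : C `<=` fixed K by apply: Cmin.
have zC v h : C v -> act v [~ z, h]%g = v by move=> Cv; apply: (CF v Cv).
have socle B : submod B -> (exists2 v, B v & v <> 0) -> B a by apply: central_socle zC za B.
split=> //; apply: (perfect_descend twK) => //.
have [q qa] := central_annihilator zC za.
have EF := tower_endo nK Kz; have [xB Fx xa] := EF.
set x := fun v => _ in qa xB Fx xa EF.
apply: (perfect_by_kernel sF (pact_endo (1 + 'X * q) sF EF)).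
  move=> v Fv; rewrite pactD pact1 => /eqP; rewrite addr_eq0 => /eqP vE.
  suff : augm v (- pact x ('X * q) v) by rewrite -vE.
  have Rs := augm_addsub v; have sR := augm_submod v.
  have Rx u : augm v u -> augm v (x u).
    by move=> Ru; apply: (addsubB Rs) => //; apply: sR.2.
  rewrite mulrC pactM // pactX //; apply: (addsubN Rs); apply: (pact_closed _ Rs Rx).
  exact: augm_mem.
exact: locally_nilpotent (pact_endo _ sF EF) qa.
Qed.

Theorem perfect_everywhere :
  (forall v, perfect_at v) /\
  forall B, submod B -> (exists2 v, B v & v <> 0) -> B a.
Proof.
case: (perfect_or_fixed towerT) => // Fa; case: (@aU 1) => h.
by rewrite /= Fa // subrr.
Qed.

End Core.

End CorePart.

(** * Abelian normal subgroups as modules *)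

Section ConjugationPart.
Import GRing.Theory.

Section AbelianModule.
Variables (P : groupType) (A : set P).
Hypotheses (nA : is_normal A) (abA : abelian_set A).

(** The additive group carried by [A]; the proofs appear as parameters so that the
    structure can be inferred from the type. *)
Definition conj_module (_ : is_normal A) (_ : abelian_set A) := {x : P | x \in A}.
Local Notation M := (conj_module nA abA).
HB.instance Definition _ := Choice.on M.

Let sA : subgroup A := nA.1.
Let inA (v : M) : A (val v) := set_mem (valP v).
Definition cm_pack x (Ax : A x) : M := exist _ x (mem_set Ax).
Definition cm_zero : M := cm_pack (subgroup1 sA).
Definition cm_opp (v : M) : M := cm_pack (subgroupV sA (inA v)).
Definition cm_add (v w : M) : M := cm_pack (subgroupM sA (inA v) (inA w)).

Fact cm_addA : associative cm_add.
Proof. by move=> u v w; apply: val_inj; rewrite /= mulgA. Qed.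
Fact cm_addC : commutative cm_add.
Proof. by move=> u v; apply: val_inj; apply: abA; apply: inA. Qed.
Fact cm_add0 : left_id cm_zero cm_add.
Proof. by move=> u; apply: val_inj; rewrite /= mul1g. Qed.
Fact cm_addN : left_inverse cm_zero cm_opp cm_add.
Proof. by move=> u; apply: val_inj; rewrite /= mulVg. Qed.

HB.instance Definition _ := GRing.isZmodule.Build M cm_addA cm_addC cm_add0 cm_addN.

Lemma cm_valD (v w : M) : val (v + w)%R = val v * val w. Proof. by []. Qed.
Lemma cm_valN (v : M) : val (- v)%R = (val v)^-1. Proof. by []. Qed.
Definition cm_act (v : M) (h : P) : M := cm_pack (nA.2 (val v) h (inA v)).

Lemma cm_val_diff (v : M) h : val (cm_act v h - v)%R = [~ val v, h].
Proof.
rewrite cm_valD cm_valN commgEl; apply: abA; first by apply: nA.2; apply: inA.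
exact: subgroupV sA (inA v).
Qed.

Lemma cm_actB h : subtractive (cm_act^~ h).
Proof.
move=> u v; apply: val_inj.
by rewrite -[LHS]/((val u * (val v)^-1) ^ h) conjMg conjVg.
Qed.

Lemma cm_actM v g h : cm_act v (g * h) = cm_act (cm_act v g) h.
Proof. by apply: val_inj; rewrite /= conjgM. Qed.

Lemma cm_act1 v : cm_act v 1 = v.
Proof. by apply: val_inj; rewrite /= conjg1. Qed.

Lemma cm_actA v h : A h -> cm_act v h = v.
Proof.
move=> Ah; apply: val_inj; rewrite /= conjgE (abA (inA v) Ah) mulKg //.
Qed.

Lemma cm_submod (B : set P) : is_normal B -> submod cm_act [set v | B (val v)].
Proof.
move=> [sB Bj]; split; last by move=> v h /=; apply: Bj.
split=> [|u v Bu Bv] /=; first exact: subgroup1.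
by change (B (val u * (val v)^-1)); apply: subgroupM => //; apply: subgroupV.
Qed.

Lemma cm_normal (B : set M) : submod cm_act B -> is_normal [set val v | v in B].
Proof.
move=> [Bs Bh]; split; last by move=> _ h [v Bv <-]; exists (cm_act v h); rewrite //; apply: Bh.
split=> [|_ _ [u Bu <-] [v Bv <-]|_ [u Bu <-]]; first by exists 0%R => //; apply: addsub0.
  by exists (u + v)%R => //; apply: addsubD.
by exists (- u)%R => //; apply: addsubN.
Qed.

Lemma cm_ucs (B : set P) k v : ucsV cm_act [set v | B (val v)] k v <-> ucs B k (val v).
Proof.
elim: k v => //= k IHk v; split=> U h; first by rewrite -cm_val_diff; apply/IHk/U.
by apply/IHk; rewrite cm_val_diff.
Qed.

(** Submodules of [A] are the normal subgroups of [P] inside [A], and I m is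
    generated by the commutators [[~ m, h]]. *)
Theorem abelian_normal_perfect a : central_tower A setT -> A a ->
  (forall k, ~ ucs [set 1] k a) ->
  (forall B, is_normal B -> B `<=` A -> (exists2 b, B b & b <> 1) ->
     exists k, ucs B k a) ->
  (forall m B, A m -> subgroup B -> (forall h, B [~ m, h]) -> B m) /\
  (forall B, is_normal B -> B `<=` A -> (exists2 b, B b & b <> 1) -> B a).
Proof.
move=> twA Aa aU aB; pose a' := cm_pack Aa.
have [|B sB [v Bv v0]|perf socle] := @perfect_everywhere M P cm_act A cm_actB cm_actM
    cm_act1 nA cm_actA twA a'.
- move=> k; have -> : [set 0%R] = [set v : M | [set 1] (val v)].
    by apply/seteqP; split=> v /= => [->|e] //; apply: val_inj.
  by move/cm_ucs; apply: aU.
- have [||k Uk] := aB _ (cm_normal sB); first by move=> _ [w _ <-]; apply: inA.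
    by exists (val v); [exists v | move=> e; apply: v0; apply: val_inj].
  exists k; have -> : B = [set v : M | [set val v | v in B] (val v)].
    apply/seteqP; split=> w; first by exists w.
    by case=> u Bu /val_inj <-.
  exact/cm_ucs.
split=> [m B Am sB Bm|B nB BA [b Bb b1]].
  have := perf (cm_pack Am) [set v | B (val v)]; apply=> [|h]; last first.
    by change (B (val (cm_act (cm_pack Am) h - cm_pack Am)%R)); rewrite cm_val_diff.
  split=> [|u v Bu Bv] /=; first exact: subgroup1.
  by change (B (val u * (val v)^-1)); apply: subgroupM => //; apply: subgroupV.
apply: (socle [set v | B (val v)]); first exact: cm_submod.
by exists (cm_pack (BA _ Bb)) => // /(congr1 val).
Qed.

End AbelianModule.

End ConjugationPart.

(** * Supplements of abelian normal subgroups *)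

Lemma commg_eq1 (G : groupType) (x y : G) : [~ x, y] = 1 <-> commute x y.
Proof. by split=> [/eqP/commgP|/commgP/eqP]. Qed.

Section Supplements.
Variable P : groupType.
Implicit Types (A B D E N V X : set P) (g h u v w x y z : P).

Definition nsg N (nN : is_normal N) : normalSubgroup P := NormalSubgroup nN.1 nN.2.

Lemma commg_sym_in N x y : subgroup N -> N [~ x, y] -> N [~ y, x].
Proof.
move=> sN Nxy; have -> : [~ y, x] = [~ x, y]^-1; last exact: subgroupV.
by rewrite /commg !conjgE !invgM !invgK !mulgA.
Qed.

(** As [A] is abelian, [[~ m, x a]] is a conjugate of [[~ m, x]], which lies in
    the normal closure of [X]. *)
Lemma supplement_contranormal A X : abelian_set A ->
  (forall g, exists x a, [/\ X x, A a & g = x * a]) ->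
  (forall B, subgroup B -> (forall m h, A m -> B [~ m, h]) -> A `<=` B) ->
  contranormal X.
Proof.
move=> abA PXA perfA; have nN := normal_closure_normal X.
have [sN Nj] := nN; have XN := @sub_normal_closure P X.
have AN : A `<=` normal_closure X.
  apply: perfA => // m g Am; have [x [a [Xx Aa ->]]] := PXA g.
  rewrite commgM_conj (commg_eq1 m a).2 ?mul1g; last exact: abA.
  by apply: Nj; apply: (normalRr _ nN); apply: XN.
apply/seteqP; split=> // g _; have [x [a [Xx Aa ->]]] := PXA g.
by apply: (subgroupM sN); [apply: XN | apply: AN].
Qed.

Section MinimalNormal.
Variables (V : set P) (c : nat).
Hypotheses (nV : is_normal V) (abV : abelian_set V).
Hypothesis minV : forall B, is_normal B -> B `<=` V -> (exists2 b, B b & b <> 1) -> V `<=` B.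
Hypothesis ncV : exists v y, V v /\ [~ v, y] <> 1.
Hypothesis nilV : ucs V c = setT.
Let sV : subgroup V := nV.1.
Let D i := ucs V i.
Let nD i : is_normal (D i). Proof. exact: ucs_normal. Qed.
Let D_le i j : (i <= j)%N -> D i `<=` D j. Proof. exact: ucs_le. Qed.

(** [D j] is the last term that centralizes [V]. *)
Lemma noncentralizing_level : exists j z,
  [/\ forall u v, D j u -> V v -> commute u v, D j.+1 z & exists2 v, V v & [~ v, z] <> 1].
Proof.
pose nc j := `[< exists u v, [/\ D j u, V v & [~ v, u] <> 1] >].
have exj : exists j, nc j.
  have [v [y [Vv vy]]] := ncV; exists c; apply/asboolP; exists y, v.
  by split=> //; rewrite /D nilV.
case: (ex_minnP exj) => j /asboolP[z [v [Dz Vv vz]]] minj.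
case: j Dz minj => [Vz _|j Dz minj]; first by case: vz; apply/commg_eq1; apply: abV.
exists j, z; split=> //; last by exists v.
move=> u w Du Vw; apply: contrapT => uw.
have /minj : nc j; last by rewrite ltnn.
apply/asboolP; exists u, w; split=> // wu; apply: uw.
by apply/commute_sym/commg_eq1.
Qed.

Section Complement.
Variables (j : nat) (z : P).
Hypothesis Dcent : forall u v, D j u -> V v -> commute u v.
Hypothesis Dz : D j.+1 z.
Hypothesis Vz : exists2 v, V v & [~ v, z] <> 1.

Lemma commgz_mor v w : V v -> V w -> [~ v * w, z] = [~ v, z] * [~ w, z].
Proof.
move=> Vv Vw; rewrite commMg_conj conjgE (abV _ Vw) ?mulKg //.
exact: normalRl.
Qed.

(** The commutators [[~ z, g]] lie in [D j] and centralize [V]: on [V], the map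
    given by [z] commutes with conjugation. *)
Lemma commgz_conj v g : V v -> [~ v, z] ^ g = [~ v ^ g, z].
Proof.
move=> Vv; rewrite conjRg; have -> : z ^ g = z * [~ z, g] by rewrite commgEl mulVKg.
rewrite commgM_conj (commg_eq1 _ _).2 ?mul1g; last first.
  by apply/commute_sym/Dcent; [exact: Dz | exact: nV.2].
have Vvz : V [~ v ^ g, z] by apply: normalRl => //; exact: nV.2.
by rewrite conjgE -(Dcent (Dz g) Vvz) mulKg.
Qed.

(** The map v -> [v, z] is a nonzero endomorphism of the minimal normal subgroup
    [V]; by Schur's argument it is bijective. *)
Lemma commgz_surj v : V v -> exists2 w, V w & [~ w, z] = v.
Proof.
pose B := [set [~ w, z] | w in V].
suff VB : V `<=` B by move/VB => [w Vw <-]; exists w.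
have BV : B `<=` V by move=> _ [w Vw <-]; apply: normalRl.
apply: minV => //; last by have [w Vw wz] := Vz; exists [~ w, z] => //; exists w.
split; last first.
  by move=> _ g [w Vw <-]; exists (w ^ g); [exact: nV.2 | rewrite commgz_conj].
split=> [|_ _ [u Vu <-] [w Vw <-]|_ [w Vw <-]].
- by exists 1; [exact: subgroup1 | rewrite comm1g].
- by exists (u * w); [exact: subgroupM | rewrite commgz_mor].
- exists w^-1; first exact: subgroupV.
  apply: (mulgI [~ w, z]); rewrite mulgV -commgz_mor ?mulgV ?comm1g //.
  exact: subgroupV.
Qed.

Lemma commgz_inj v : V v -> [~ v, z] = 1 -> v = 1.
Proof.
move=> Vv vz; apply: contrapT => v1; have [w Vw] := Vz; case.
pose B := [set u | V u /\ [~ u, z] = 1].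
suff VB : V `<=` B by case: (VB w Vw).
apply: minV => [|u []//|]; last by exists v.
split; last first.
  by move=> u g [Vu uz]; split; [exact: nV.2 | rewrite -commgz_conj // uz conj1g].
split=> [|x y [Vx xz] [Vy yz]|x [Vx xz]].
- by split; [exact: subgroup1 | rewrite comm1g].
- by split; [exact: subgroupM | rewrite commgz_mor // xz yz mulg1].
- split; first exact: subgroupV.
  have := commgz_mor (subgroupV sV Vx) Vx.
  by rewrite mulVg comm1g xz mulg1.
Qed.

(** Elements of [D i] that [z] centralizes modulo the previous stage; they form a
    normal complement of [V] in [D i] as long as [D i] centralizes [V]. *)
Fixpoint mod_complement i : set P :=
  if i is i'.+1 then [set w | D i'.+1 w /\ mod_complement i' [~ w, z]] else [set 1].

Definition mod_complement_good i : Prop :=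
  [/\ is_normal (mod_complement i), mod_complement i `<=` D i, forall v, V v -> mod_complement i v -> v = 1 &
      forall w, D i w -> exists e v, [/\ mod_complement i e, V v & w = e * v]].

Section Step.
Variable i : nat.

Hypothesis good : mod_complement_good i.
Let E := mod_complement i.
Let nE : is_normal E. Proof. by case: good. Qed.
Local Notation cs := (coset_of (nsg nE)).

(** The commutator with [z] can be moved into [E] by a factor from [V], since
    every element of [V] is a commutator with [z]. *)
Lemma correct_mod w : D i [~ w, z] -> exists v, V v /\ E [~ w * v, z].
Proof.
case: good => _ ED Ecap DE /DE[e [v [Ee Vv wz]]].
have [v0 Vv0 v0z] := commgz_surj (subgroupV sV Vv).
exists v0; split=> //; rewrite commMg_conj wz v0z conjMg.
have -> : v ^ v0 = v by rewrite conjgE (abV Vv Vv0) mulKg.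
by rewrite mulgK; apply: nE.2.
Qed.

(** Let [v] in [V] represent [[~ e, u]] modulo [E], where [z] centralizes [e].
    Conjugation by [z] replaces [u] by u [u, z], and the factor [u, z] lies one
    level lower, where the claim is known; so [z] centralizes [v], and v = 1. *)
Lemma mod_complement_comm e : (i < j)%N -> D i.+1 e -> E [~ e, z] ->
  forall m u, (m <= j)%N -> D m u -> E [~ e, u].
Proof.
move=> lt_ij De Ez; have [_ ED Ecap DE] := good.
elim=> [|m IHm] u mj Du.
  rewrite (commg_eq1 _ _).2; first exact: subgroup1 nE.1.
  by apply: Dcent Du; apply: D_le De.
have Duz : D m [~ u, z] by apply: Du.
have [e1 [v [Ee1 Vv euE]]] := DE _ (De u).
rewrite euE (_ : v = 1) ?mulg1 //; apply: commgz_inj => //.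
apply: Ecap; first exact: normalRl.
apply/(coset_of_eq1 (nsg nE)); rewrite coset_ofR.
have csE x : E x -> cs x = 1 by move/(coset_of_eq1 (nsg nE)).
have ez : commute (cs e) (cs z) by apply/commg_eq1; rewrite -coset_ofR csE.
have eu' : commute (cs e) (cs [~ u, z]).
  by apply/commg_eq1; rewrite -coset_ofR csE //; apply: IHm => //; apply: ltnW.
have vE : cs v = [~ cs e, cs u].
  by rewrite -coset_ofR euE coset_ofM (csE e1) // mul1g.
have vu' : commute (cs v) (cs [~ u, z]).
  apply/commg_eq1; rewrite -coset_ofR (commg_eq1 _ _).2 //.
  by apply/commute_sym/Dcent => //; apply: D_le Duz; apply: ltnW.
have vz : cs v ^ cs z = cs v.
  rewrite vE conjRg.
  have -> : cs e ^ cs z = cs e by rewrite conjgE ez mulKg.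
  have -> : cs u ^ cs z = cs u * cs [~ u, z] by rewrite coset_ofR commgEl mulVKg.
  rewrite commgM_conj (commg_eq1 _ _).2 // mul1g -vE conjgE vu' mulKg //.
exact/eqP/conjg_fixP.
Qed.

Lemma mod_complement_step : (i < j)%N -> mod_complement_good i.+1.
Proof.
move=> lt_ij; have [_ ED Ecap DE] := good; have [sE Ej] := nE.
have Ewz w : mod_complement i.+1 w -> E [~ w, z] by case.
split; last first.
- move=> w Dw; have [v [Vv Ewv]] := correct_mod (Dw z).
  exists (w * v), v^-1; split; last by rewrite mulgK.
    split=> //; apply: (subgroupM (nD i.+1).1) => //.
    exact: (D_le (leq0n i.+1)).
  exact: subgroupV.
- move=> v Vv [_ vz]; apply: commgz_inj => //; apply: Ecap => //; exact: normalRl.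
- by move=> w [].
split.
  split=> [|x y [Dx xz] [Dy yz]|x [Dx xz]].
  - by split; [exact: subgroup1 (nD _).1 | rewrite comm1g; exact: subgroup1].
  - split; first exact: subgroupM (nD _).1 _ _.
    by rewrite commMg_conj; apply: subgroupM => //; apply: Ej.
  - split; first exact: subgroupV (nD _).1 _.
    apply: (normal_conjr (x := x) nE).
    have := commMg_conj x^-1 x z; rewrite mulVg comm1g => e.
    by apply: (subgroupMr sE xz); rewrite -e; apply: subgroup1.
move=> e g [De ez]; split; first exact: (nD _).2.
rewrite -[z](conjgKV g) -conjRg; apply: nE.2.
have -> : z ^ g^-1 = z * [~ z, g^-1] by rewrite commgEl mulVKg.
rewrite commgM_conj; apply: (subgroupM sE); last exact: Ej.
exact: (mod_complement_comm lt_ij De ez (leqnn j)).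
Qed.

End Step.

Lemma mod_complement_goodP i : (i <= j)%N -> mod_complement_good i.
Proof.
elim: i => [_|i IHi ij]; last exact: mod_complement_step (IHi (ltnW ij)) ij.
split=> /=.
- split; last by move=> h g ->; rewrite conj1g.
  by split=> [|x y -> ->|x ->]; rewrite ?mulg1 ?invg1.
- by move=> w ->; apply: subgroup1.
- by [].
- by move=> w Vw; exists 1, w; rewrite mul1g.
Qed.

(** The centralizer of [z] modulo the complement of [V] in [D j]. *)
Lemma proper_supplement_at : exists X, [/\ subgroup X,
  (forall g, exists x a, [/\ X x, V a & g = x * a]) & X <> setT].
Proof.
have good := mod_complement_goodP (leqnn j); have [nE ED Ecap DE] := good.
exists [set g | mod_complement j [~ g, z]]; split.
- have := commg_subgroup z nE; congr subgroup.
  by apply/seteqP; split=> g /= /(commg_sym_in nE.1).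
- move=> g; have [|v [Vv Egv]] := @correct_mod j good g.
    by apply: (commg_sym_in (nD j).1); apply: Dz.
  by exists (g * v), v^-1; split=> //; [exact: subgroupV | rewrite mulgK].
have [v Vv vz] := Vz; move=> XT; have : [set: P] v by [].
rewrite -XT /= => /Ecap; move=> /(_ (normalRl _ nV Vv)) //.
Qed.

End Complement.

(** The extension by [V] splits.  The complement is built as a centralizer, which
    replaces the vanishing of cohomology in degree two. *)
Lemma proper_supplement : exists X, [/\ subgroup X,
  (forall g, exists x a, [/\ X x, V a & g = x * a]) & X <> setT].
Proof.
have [j [z [Dcent Dz Vz]]] := noncentralizing_level.
exact: proper_supplement_at Dcent Dz Vz.
Qed.

End MinimalNormal.
End Supplements.

(** * Finite normal subgroups *)

Section FiniteSubgroup.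
Import fingroup morphism pgroup center sylow Defs.

Variables (P : groupType) (s : seq P).
Hypothesis sS : is_normal [set` s].

(** The finite group carried by [s]; the proof appears as a parameter so that the
    group structure can be inferred from the type. *)
Definition fin_subgroup (_ : is_normal [set` s]) := seq_sub s.
Local Notation F := (fin_subgroup sS).
HB.instance Definition _ := Finite.on F.

Let sg := sS.1.
Let inF (v : F) : ssval v \in s := ssvalP v.
Definition fs_one : F := SeqSub (subgroup1 sg).
Definition fs_inv (u : F) : F := SeqSub (subgroupV sg (inF u)).
Definition fs_mul (u v : F) : F := SeqSub (subgroupM sg (inF u) (inF v)).

Fact fs_mulA : associative fs_mul.
Proof. by move=> u v w; apply: val_inj; rewrite /= mulgA. Qed.
Fact fs_mul1 : left_id fs_one fs_mul.
Proof. by move=> u; apply: val_inj; rewrite /= mul1g. Qed.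
Fact fs_mulr1 : right_id fs_one fs_mul.
Proof. by move=> u; apply: val_inj; rewrite /= mulg1. Qed.
Fact fs_mulV : left_inverse fs_one fs_inv fs_mul.
Proof. by move=> u; apply: val_inj; rewrite /= mulVg. Qed.
Fact fs_mulrV : right_inverse fs_one fs_inv fs_mul.
Proof. by move=> u; apply: val_inj; rewrite /= mulgV. Qed.

HB.instance Definition _ := isGroup.Build F fs_mulA fs_mul1 fs_mulr1 fs_mulV fs_mulrV.


Local Notation Ft := (finset.setTfor F).

Definition fs_conj g (u : F) : F := SeqSub (sS.2 (ssval u) g (inF u)).

Fact fs_conjM g : {in Ft &, {morph fs_conj g : u v / u * v}}.
Proof. by move=> u v _ _; apply: val_inj; rewrite /= conjMg. Qed.

Canonical fs_conj_morphism g := Morphism (@fs_conjM g).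

Lemma fs_conj_inj g : 'injm (fs_conj g).
Proof.
apply/injmP => u v _ _ /(congr1 val) /= e; apply: val_inj => /=.
exact: conjg_inj e.
Qed.

Definition fs_pre (K : set P) : {set F} := finset.finset (fun u : F => `[<K (ssval u)>]).

Lemma in_fs_pre K u : (u \in fs_pre K) = `[<K (ssval u)>].
Proof. by rewrite finset.inE. Qed.

Lemma fs_pre_group K : subgroup K -> group_set (fs_pre K).
Proof.
move=> sK; apply/group_setP; split=> [|u v]; rewrite !in_fs_pre.
  by apply/asboolP; apply: (subgroup1 sK).
by move=> /asboolP Ku /asboolP Kv; apply/asboolP; apply: (subgroupM sK).
Qed.

Definition fs_img (A : {set F}) : set P := [set x | exists2 u : F, u \in A & ssval u = x].

Lemma fs_img_sub (S : {group F}) : subgroup (fs_img S).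
Proof.
split=> [|_ _ [u Su <-] [v Sv <-]|_ [u Su <-]].
- by exists 1; [exact: group1 | ].
- by exists (u * v); [exact: groupM | ].
- by exists u^-1; [rewrite groupV | ].
Qed.

(** Frattini's argument inside the normal closure [K] of the normalizer [N] of
    [S]: [S] and its conjugate by [g] are Sylow subgroups of the finite part of
    [K], hence conjugate in [K], and so [g] lies in K N = K.  Thus [N] is
    contranormal. *)
Lemma sylow_normal p (S : {group F}) : contranormal_free P ->
  p.-Sylow(Ft) S -> forall g x, fs_img S x -> fs_img S (x ^ g).
Proof.
move=> cf sylS; pose N := [set g | (forall x, fs_img S x -> fs_img S (x ^ g)) /\
                                  (forall x, fs_img S x -> fs_img S (x ^ g^-1))].
have sN : subgroup N.
  split=> [|g h [Ng Ng'] [Nh Nh']|g [Ng Ng']]; split=> x Sx.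
  - by rewrite conjg1.
  - by rewrite invg1 conjg1.
  - by rewrite conjgM; apply/Nh/Ng.
  - by rewrite invgM conjgM; apply/Ng'/Nh'.
  - exact: Ng'.
  - by rewrite invgK; apply: Ng.
suff NT : N = setT by move=> g x; have [Ng _] : N g by [rewrite NT]; apply: Ng.
apply: cf => //; apply/seteqP; split=> // g _.
pose K := normal_closure N; have [sK Kj] : is_normal K := normal_closure_normal N.
have NK : N `<=` K := @sub_normal_closure P N.
pose KF := Group (fs_pre_group sK).
have sS_KF : S \subset KF.
  apply/fintype.subsetP => u Su; rewrite in_fs_pre; apply/asboolP; apply: NK.
  have Sv : fs_img S (ssval u) by exists u.
  have sI := fs_img_sub S.
  split=> x Sx; first exact: (subgroupJ sI Sx Sv).
  exact: (subgroupJ sI Sx (subgroupV sI Sv)).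
have sylK : p.-Sylow(KF) S by apply: (pHall_subl sS_KF _ sylS); exact: finset.subsetT.
pose Sg := [group of fs_conj g @* S].
have sylKg : p.-Sylow(KF) Sg.
  rewrite pHallE card_injm ?fs_conj_inj ?finset.subsetT //.
  move: (sylK); rewrite pHallE => /andP[_ ->]; rewrite andbT.
  apply/fintype.subsetP => _ /morphimP[u _ Su ->]; rewrite in_fs_pre.
  apply/asboolP; apply: Kj; move/fintype.subsetP: sS_KF => /(_ u Su).
  by rewrite in_fs_pre => /asboolP.
have [f KFf SgE] := Sylow_trans sylK sylKg.
have Kf : K (ssval f) by move: KFf; rewrite in_fs_pre => /asboolP.
rewrite -(mulgVK (ssval f) g); apply: (subgroupM sK) => //.
apply: NK; split=> _ [u Su <-].
  have : fs_conj g u \in (S :^ f)%g.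
    by rewrite -SgE; apply: mem_morphim => //; rewrite finset.in_setT.
  case/finset.imsetP=> w Sw /(congr1 val) e.
  have {}e : ssval u ^ g = ssval w ^ ssval f := e.
  by exists w => //; rewrite conjgM e conjgK.
have : (u ^ f)%g \in Sg by rewrite SgE memJ_conjg.
case/morphimP=> w _ Sw /(congr1 val) e.
have {}e : ssval u ^ ssval f = ssval w ^ g := e.
by exists w => //; rewrite invgM invgK conjgM e conjgK.
Qed.

(** The centre of a normal Sylow subgroup of the finite normal subgroup. *)
Theorem finite_normal_abelian : contranormal_free P -> (exists2 x, x \in s & x <> 1) ->
  exists A : set P, [/\ is_normal A, abelian_set A & exists2 a, A a & a <> 1].
Proof.
move=> cf [x xs x1].
have cF : (1 < #|Ft|)%N.
  rewrite cardG_gt1; apply/eqP => F1.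
  have : (SeqSub xs : F) \in Ft by rewrite finset.in_setT.
  by rewrite F1 => /finset.set1P /(congr1 val).
have [S sylS] := Sylow_exists (pdiv #|Ft|) [set: F]%G.
have S1 : S :!=: 1.
  rewrite -cardG_gt1 (card_Hall sylS) p_part_gt1.
  by rewrite mem_primes pdiv_prime // cardG_gt0 pdiv_dvd.
have pS : (pdiv #|Ft|).-group S := pHall_pgroup sylS.
have Sj := sylow_normal cf sylS; have sI := fs_img_sub S.
exists [set y | fs_img S y /\ forall z, fs_img S z -> commute y z]; split.
- split; last first.
    move=> y g [Sy cy]; split; first exact: Sj.
    move=> z Sz; have e := congr1 (conjg^~ g) (cy _ (Sj g^-1 z Sz)).
    by move: e; rewrite /= (conjMg y) (conjMg _ y) conjgKV.
  split=> [|y z [Sy cy] [Sz cz]|y [Sy cy]].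
  + by split=> [|z _]; [exact: subgroup1 | exact/commute_sym/commute1].
  + by split=> [|w Sw]; [exact: subgroupM | apply/commute_sym/commuteM; apply/commute_sym; [apply: cy|apply: cz]].
  + by split=> [|w Sw]; [exact: subgroupV | apply/commute_sym/commuteV/commute_sym/cy].
- by move=> y z [Sy cy] [Sz cz]; apply: cy.
have [u Zu u1] : exists2 u, u \in 'Z(S)%g & u != 1.
  by apply/trivgPn; apply: contraNneq S1 => /(trivg_center_pgroup pS) ->.
exists (ssval u); last by move=> e; case/eqP: u1; apply: val_inj.
case/centerP: Zu => Su cu; split; first by exists u.
by move=> _ [v Sv <-]; have /(congr1 val) := cu v Sv.
Qed.

End FiniteSubgroup.

(** * Finitely generated contranormal-free groups *)

Definition nilpotent_mod (P : groupType) (N : set P) : Prop :=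
  exists k, ucs N k = setT.

Lemma nilpotent_modS (P : groupType) (N M : set P) :
  N `<=` M -> nilpotent_mod N -> nilpotent_mod M.
Proof.
move=> NM [k Uk]; exists k; apply/seteqP; split=> // x _.
by apply: (ucs_mono NM); rewrite Uk.
Qed.

Lemma nilpotent_mod_quotient (P : groupType) (N : normalSubgroup P) :
  nilpotent_mod [set 1 : quotient_group N] <-> nilpotent_mod N.
Proof.
split=> -[k Uk]; exists k; apply/seteqP; split=> // x _.
  by apply/ucs_quotient; rewrite Uk.
by have [y <-] := coset_of_surj x; apply/ucs_quotient; rewrite Uk.
Qed.

Lemma generatedU (P : groupType) (A : set P) (X : seq P) :
  generated [set` X] = setT -> generated (A `|` [set` X]) = setT.
Proof.
move=> gT; apply/seteqP; split=> // x _; have : [set: P] x by [].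
rewrite -gT; apply: generated_sub; first exact: generated_subgroup.
by move=> y Xy; apply: sub_generated; right.
Qed.

Lemma generated_quotient (P : groupType) (N : normalSubgroup P) (A : set P) (X : seq P) :
  generated (A `|` [set` X]) = setT ->
  generated ((coset_of N @` A) `|` [set` map (coset_of N) X]) = setT.
Proof.
move=> gT; apply/seteqP; split=> // u _; have [x <-] := coset_of_surj u.
set B := _ `|` _; have sB := generated_subgroup B.
apply: (generates_ind (subgroup_preim sB) gT) => y.
  by move=> Ay; apply: sub_generated; left; exists y.
by move=> Xy; apply: sub_generated; right; apply: map_f.
Qed.

Lemma generated_quotient0 (P : groupType) (N : normalSubgroup P) (X : seq P) :
  generated [set` X] = setT -> generated [set` map (coset_of N) X] = setT.
Proof.
move=> gT; have := @generated_quotient P N set0 X; rewrite set0U => /(_ gT).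
by rewrite image_set0 set0U.
Qed.

Section JustNonNilpotent.
Variable P : groupType.
Implicit Types (A B M N V : set P) (X : seq P).

Lemma center_free_ucs k : ucs [set 1 : P] 1 `<=` [set 1] -> ucs [set 1 : P] k `<=` [set 1].
Proof.
move=> Z1; elim: k => //= k IHk x Ux; apply: Z1 => y; exact/IHk.
Qed.

Lemma is_normal1 : is_normal [set 1 : P].
Proof.
by split=> [|h x ->]; [split=> [|x y -> ->|x ->]; rewrite ?mulg1 ?invg1 | rewrite conj1g].
Qed.

(** The centre is trivial, so a nontrivial [a] in [A] satisfies the hypotheses
    of [abelian_normal_perfect].  The normal closure [V] of [a] is then minimal
    normal with [V = [V, P]], and its proper supplement is contranormal. *)
Lemma just_non_nilpotent_abelian X : generated [set` X] = setT -> contranormal_free P ->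
  (forall N, is_normal N -> (exists2 x, N x & x <> 1) -> nilpotent_mod N) ->
  ~ nilpotent_mod [set 1 : P] ->
  forall A, is_normal A -> abelian_set A -> A `<=` [set 1].
Proof.
move=> gT cf jnn nnil A nA abA a Aa; apply: contrapT => a1.
have Z1 : ucs [set 1 : P] 1 `<=` [set 1].
  move=> b Zb; apply: contrapT => b1; apply: nnil.
  have [|k Uk] := jnn _ (ucs_normal 1 is_normal1); first by exists b.
  by exists (1 + k)%N; rewrite ucs_add.
have aU k : ~ ucs [set 1] k a by move/(center_free_ucs Z1).
have [c Ac] : nilpotent_mod A by apply: jnn => //; exists a.
have twA := central_tower_exists nA (generatedU A gT) Ac.
have [|perf socle] := abelian_normal_perfect nA abA twA Aa aU.
  move=> B nB BA nB1; have [k Bk] := jnn B nB nB1; by exists k; rewrite Bk.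
pose V := [set x | forall B, is_normal B -> B a -> B x].
have nV : is_normal V.
  split; last by move=> h x Vh B nB Ba; apply: nB.2; apply: Vh.
  split=> [B nB _|x y Vx Vy B nB Ba|x Vx B nB Ba]; first exact: subgroup1 nB.1.
    by apply: (subgroupM nB.1); [apply: Vx | apply: Vy].
  by apply: (subgroupV nB.1); apply: Vx.
have VA : V `<=` A by move=> x; apply.
have Va : V a by move=> B.
have abV : abelian_set V by move=> x y /VA Ax /VA Ay; apply: abA.
have [d Vd] : nilpotent_mod V by apply: jnn => //; exists a.
have [||X0 [sX VX0 nX]] := @proper_supplement P V d nV abV _ _ Vd.
- move=> B nB BV nB1 x Vx; apply: Vx => //; apply: socle => //.
  exact: subset_trans VA.
- exists a; apply: contrapT => noy; apply: a1; apply: Z1 => y /=.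
  by apply: contrapT => ay; apply: noy; exists y.
apply: nX; apply: cf => //; apply: (supplement_contranormal abV VX0).
by move=> B sB BV m Vm; apply: perf (VA _ Vm) sB _ => h; apply: BV.
Qed.

(** Nilpotency of a finitely generated quotient is witnessed by finitely many
    words. *)
Lemma nilpotent_mod_chain X (F : set (set P)) : generated [set` X] = setT ->
  F !=set0 -> total_on F subset -> (forall N, F N -> is_normal N) ->
  nilpotent_mod (\bigcup_(N in F) N) -> exists2 N, F N & nilpotent_mod N.
Proof.
move=> gT F0 totF nF [k Uk].
have nU := normal_bigcup F0 totF nF.
have wordsE N x : is_normal N ->
    ucs N k x <-> forall y, y \in comm_words X k x -> N y.
  move=> nN; apply: (ucs_words (A := [set 1]) (W := setT)) => //.
    exact: generatedU.
  by move=> w a _ ->; rewrite commg1.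
have [|N FN Nw] := @chain_finite P F (flatten [seq comm_words X k x | x <- X]) F0 totF.
  move=> y /flatten_mapP[x Xx xy].
  have : ucs (\bigcup_(N in F) N) k x by rewrite Uk.
  by move/(wordsE _ x nU); apply.
exists N => //; exists k; apply/seteqP; split=> // y _.
have nN := nF N FN.
apply: (generates_ind (A := set0) (ucs_normal k nN).1 (generatedU _ gT)) => // x Xx.
by apply/wordsE => // z zx; apply: Nw; apply/flatten_mapP; exists x.
Qed.

End JustNonNilpotent.

(** A normal subgroup maximal among those with non-nilpotent quotient. *)
Theorem non_nilpotent_image (P : groupType) (X : seq P) :
  generated [set` X] = setT -> contranormal_free P -> ~ nilpotent_mod [set 1 : P] ->
  exists N : normalSubgroup P, ~ nilpotent_mod N /\
    forall M : set P, is_normal M ->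
      abelian_set (coset_of N @` M) \/ finite_set (coset_of N @` M) -> M `<=` N.
Proof.
move=> gT cf nnil.
have [|||N0 [[nN0 nnilN] maxN]] :=
  @Zorn_nonempty P (fun N => is_normal N /\ ~ nilpotent_mod N).
- by move=> N [nN _]; apply: subgroup1 nN.1.
- move=> F F0 totF FP; split; first by apply: normal_bigcup => // N /FP[].
  case/(nilpotent_mod_chain gT F0 totF) => [N /FP[]//|N /FP[_ nn]]; exact: nn.
- by exists [set 1]; split=> //; apply: is_normal1.
pose N := nsg nN0; exists N; split=> // M nM abfin.
have gTQ := @generated_quotient0 P N X gT.
have cfQ := @contranormal_free_quotient P N cf.
have nnilQ : ~ nilpotent_mod [set 1 : quotient_group N] by move/nilpotent_mod_quotient.
have jnn B : is_normal B -> (exists2 x, B x & x <> 1 :> quotient_group N) -> nilpotent_mod B.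
  move=> nB [u Bu u1]; pose B' := coset_of N @^-1` B.
  have nB' : is_normal B' by apply: normal_preim.
  have [[k Uk]|nnB] := pselect (nilpotent_mod B').
    exists k; apply/seteqP; split=> // v _; have [x <-] := coset_of_surj v.
    by apply/ucs_preim; rewrite -/B' Uk.
  case: u1; have [x xu] := coset_of_surj u; rewrite -xu; apply/coset_of_eq1.
  apply: (maxN B') => //; last by rewrite /B' /= xu.
  by move=> y Ny; rewrite /B' /= (coset_of_eq1 N y).2 //; apply: subgroup1 nB.1.
have noab := just_non_nilpotent_abelian gTQ cfQ jnn nnilQ.
suff M1 : coset_of N @` M `<=` [set 1].
  by move=> x Mx; apply/(coset_of_eq1 N); apply: M1; exists x.
have nMQ := @normal_im P N M nM.
case: abfin => [|/finite_seqP[s sE]]; first exact: noab.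
move=> u Mu; apply: contrapT => u1.
rewrite sE in nMQ Mu.
have [|A [nA abA [b Ab b1]]] := finite_normal_abelian nMQ cfQ; first by exists u.
exact/b1/(noab A nA abA).
Qed.

(** Let [N] be the subgroup of [non_nilpotent_image].  The first term of the
    series outside [N] has a predecessor inside [N], so its image modulo [N]
    is abelian or finite. *)
Theorem fg_hyper_nilpotent (Q : groupType) : finitely_generated Q ->
  hyper_abelian_or_finite Q -> contranormal_free Q -> nilpotent_mod [set 1 : Q].
Proof.
move=> [S [/finite_seqP[X ->] gT]] [d [I [Qs [[wf Q0 Qle Qlim] QT Qfac]]]] cf.
apply: contrapT => /(non_nilpotent_image gT cf)[N [nnil Nmax]].
have bad : exists b, ~ (Qs b `<=` N).
  exists \top%O; rewrite QT => TN; apply: nnil; exists 0%N.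
  by apply/seteqP; split.
have [b nb minb] : exists2 b, ~ (Qs b `<=` N) & forall a, (a < b)%O -> Qs a `<=` N.
  have [b nb] := bad; elim/(well_founded_ind wf): b nb => b IHb nb.
  have [[a [ab na]]|noa] := pselect (exists a, (a < b)%O /\ ~ (Qs a `<=` N)).
    exact: IHb na.
  by exists b => // a ab; apply: contrapT => na; apply: noa; exists a.
have [[a ab]|nosucc] := pselect (exists a, is_succ a b).
  have aN : Qs a `<=` N by apply: minb; case: ab.
  apply: nb; apply: Nmax; first exact: nsg_normal.
  case: (Qfac a b ab) => [abf|finf]; [left | right].
    move=> _ _ [x Qx <-] [y Qy <-]; apply/commg_eq1; rewrite -coset_ofR.
    apply/coset_of_eq1/aN/(coset_of_eq1 (Qs a)); rewrite coset_ofR.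
    by apply/commg_eq1/abf; [exists x | exists y].
  have := finite_image (fun u => coset_of N (repr u)) finf; congr finite_set.
  have cE x : coset_of N (repr (coset_of (Qs a) x)) = coset_of N x.
    apply/coset_ofP/aN/coset_ofP; exact: coset_reprK.
  apply/seteqP; split=> [_ [_ [x Qx <-] <-]|_ [x Qx <-]].
    by exists x; rewrite ?cE.
  by exists (coset_of (Qs a) x); [exists x | rewrite cE].
apply: nb; have [b0|b0] := eqVneq b \bot%O.
  by rewrite b0 Q0 => x ->; apply: subgroup1 (nsg_subgroup N).
rewrite Qlim; first by move=> x [a ab Qx]; apply: minb Qx.
by split=> [|a ab]; [apply/eqP | apply: nosucc; exists a].
Qed.

(** * Abelian normal subgroups of contranormal-free groups *)

Lemma subgroup_mul_normal (P : groupType) (A X : set P) : is_normal A -> subgroup X ->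
  subgroup [set g | exists x a, [/\ X x, A a & g = x * a]].
Proof.
move=> [sA Aj] sX; split.
- by exists 1, 1; rewrite mulg1; split; [exact: subgroup1 | exact: subgroup1 |].
- move=> _ _ [x [a [Xx Aa ->]]] [y [b [Xy Ab ->]]].
  exists (x * y), (a ^ y * b); split; [exact: subgroupM | by apply: subgroupM => //; apply: Aj |].
  by rewrite conjgE !mulgA mulgK.
move=> _ [x [a [Xx Aa ->]]]; exists x^-1, (a^-1 ^ x^-1).
by split; [exact: subgroupV | apply: Aj; exact: (subgroupV sA Aa) | rewrite invgM -conjgC].
Qed.

(** Choose [N] in [A] maximal with [a] outside every [ucs N k].  Modulo [N] the
    subgroup generated by lifts of [X] supplements the image [B] of [A], which
    satisfies [B = [B, P]], so it is everything.  In the finitely generated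
    quotient so obtained, [non_nilpotent_image] swallows [B]. *)
Theorem locally_central_abelian (P : groupType) (A : set P) (X : seq P) :
  contranormal_free P -> is_normal A -> abelian_set A ->
  generated (A `|` [set` X]) = setT -> nilpotent_mod A ->
  forall a, A a -> exists k, ucs [set 1] k a.
Proof.
move=> cf nA abA gT [c Ac] a Aa; apply: contrapT => noa.
pose good N := [/\ is_normal N, N `<=` A & forall k, ~ ucs N k a].
have [|||N0 [[nN0 NA nNa] maxN]] := @Zorn_nonempty P good.
- by move=> N [nN _ _]; apply: subgroup1 nN.1.
- move=> F F0 totF FP.
  have nU : is_normal (\bigcup_(N in F) N) by apply: normal_bigcup => // N /FP[].
  have wordsE N k : is_normal N ->
      ucs N k a <-> forall y, y \in comm_words X k a -> N y.
    move=> nN; apply: (ucs_words (A := A) (W := A)) => //.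
      by move=> w x Aw; apply: normalRl.
    by move=> w b Aw Ab; apply/commg_eq1/abA.
  split=> // [x [N /FP[_ NA _]]|k /(wordsE _ k nU) Uw]; first exact: NA.
  have [N FN Nw] := chain_finite F0 totF Uw.
  by have [nN _ /(_ k)] := FP N FN; apply; apply/wordsE.
- exists [set 1]; split; first exact: is_normal1.
    by move=> x ->; apply: subgroup1 nA.1.
  by move=> k Uk; apply: noa; exists k.
pose N := nsg nN0; pose cs := coset_of N.
pose B := cs @` A.
have nB : is_normal B by apply: normal_im.
have abB : abelian_set B.
  by move=> _ _ [x Ax <-] [y Ay <-]; rewrite /commute -!coset_ofM; congr (coset_of _ _); apply: abA.
have gTQ : generated (B `|` [set` map cs X]) = setT by apply: generated_quotient.
have preB : cs @^-1` B = A by apply: preim_im; [case: nA | exact: NA].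
have Bc : ucs B c = setT.
  apply/seteqP; split=> // u _; have [x <-] := coset_of_surj u.
  by apply/ucs_preim; rewrite -/cs preB Ac.
have twB := central_tower_exists nB gTQ Bc.
have cfQ := @contranormal_free_quotient P N cf.
have nca k : ~ ucs [set 1] k (cs a) by move/ucs_quotient; apply: nNa.
have [|perf _] := abelian_normal_perfect nB abB twB (ex_intro2 _ _ a Aa erefl) nca.
  move=> D nD DB [d Dd d1]; pose D' := cs @^-1` D.
  have nD' : is_normal D' by apply: normal_preim.
  have D'A : D' `<=` A by move=> x Dx; rewrite -preB; apply: DB.
  apply: contrapT => noD; case: d1.
  have [x xd] := coset_of_surj d; rewrite -xd; apply/coset_of_eq1.
  apply: (maxN D'); last by rewrite /D' /= /cs xd.
    by split=> // k Uk; apply: noD; exists k; apply/ucs_preim.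
  by move=> y Ny; rewrite /D' /= /cs (coset_of_eq1 N y).2 //; apply: subgroup1 nD.1.
pose Y := generated [set` map cs X].
have sY : subgroup Y := generated_subgroup _.
have YB g : exists x b, [/\ Y x, B b & g = x * b].
  apply: (generates_ind (subgroup_mul_normal nB sY) gTQ) => y => [By|Xy].
    by exists 1, y; rewrite mul1g; split=> //; apply: subgroup1.
  exists y, 1; rewrite mulg1; split=> //; last exact: subgroup1 nB.1.
  by apply: sub_generated.
have YT : Y = setT.
  apply: cfQ => //; apply: (supplement_contranormal abB YB) => D sD BD m Bm.
  by apply: perf => // h; apply: BD.
have nnilQ : ~ nilpotent_mod [set 1 : quotient_group N].
  by case=> k Uk; apply: (nca k); rewrite Uk.
have [M [nnilM maxM]] := non_nilpotent_image YT cfQ nnilQ.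
apply: nnilM; apply: (nilpotent_modS (N := B)); last by exists c.
apply: maxM => //; left=> _ _ [x Bx <-] [y By <-].
by rewrite /commute -!coset_ofM; congr (coset_of _ _); apply: abB.
Qed.

(** * Lifting from the abelianization along the lower central series *)

Section Hall.
Variables (G : groupType) (L : set G).
Hypothesis nL : is_normal L.
Let gam := lower_central L.

Lemma lower_central_normal i : is_normal (gam i).
Proof.
elim: i => [|i [_ gj]] //=; apply: generated_normal => _ g [x gx [y Ly <-]].
rewrite conjRg; apply: sub_generated; exists (x ^ g); first exact: gj.
by exists (y ^ g) => //; apply: nL.2.
Qed.

Lemma lower_centralR i x y : gam i x -> L y -> gam i.+1 [~ x, y].
Proof. by move=> gx Ly; apply: sub_generated; exists x => //; exists y. Qed.

Lemma lower_centralS i : gam i.+1 `<=` gam i.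
Proof.
apply: generated_sub; first exact: (lower_central_normal i).1.
by move=> _ [x gx [y _ <-]]; apply: normalRl gx; apply: lower_central_normal.
Qed.

Lemma lower_central_sub i : gam i `<=` L.
Proof. by elim: i => [|i IHi] // x /lower_centralS/IHi. Qed.

Section Bilinear.
Variable i : nat.
Let T := gam i.+2.
Let nT : is_normal T := lower_central_normal i.+2.
Local Notation cs := (coset_of (nsg nT)).

Lemma lower_central_comm x y : gam i.+1 x -> L y -> commute (cs x) (cs y).
Proof.
move=> gx Ly; apply/commg_eq1; rewrite -coset_ofR; apply/coset_of_eq1.
exact: lower_centralR.
Qed.

(** For fixed [u] the map v -> [u, v] modulo [T] is a homomorphism from [L] to an
    abelian group, so it vanishes on commutators. *)
Lemma comm_derived u v : gam i u -> gam 1 v -> T [~ u, v].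
Proof.
move=> gu; pose S := [set v | L v /\ T [~ u, v]].
suff gS : gam 1 `<=` S by move/gS => [].
have sC := commg_subgroup u nT; have sL := nL.1.
apply: generated_sub.
  split=> [|x y [Lx Tx] [Ly Ty]|x [Lx Tx]].
  - by split; [exact: subgroup1 | exact: subgroup1 sC].
  - by split; [exact: subgroupM | exact: subgroupM sC _ _].
  - by split; [exact: subgroupV | exact: subgroupV sC _].
move=> _ [x Lx [y Ly <-]]; split; first exact: normalRl.
have phiM a b : L a -> L b -> [~ cs u, cs a * cs b] = [~ cs u, cs b] * [~ cs u, cs a].
  move=> La Lb; rewrite commgM_conj; congr (_ * _); rewrite conjgE -coset_ofR.
  by rewrite (lower_central_comm (lower_centralR gu La) Lb) mulKg.
apply/(coset_of_eq1 (nsg nT)); rewrite !coset_ofR.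
have := phiM (y * x) [~ x, y] (subgroupM sL Ly Lx) (normalRl y nL Lx).
have -> : cs (y * x) * cs [~ x, y] = cs x * cs y by rewrite -!coset_ofM -commgC.
rewrite coset_ofM (phiM x y Lx Ly) (phiM y x Ly Lx) coset_ofR => e.
have cyx : commute [~ cs u, cs x] [~ cs u, cs y].
  rewrite -!coset_ofR; apply: lower_central_comm; first exact: lower_centralR.
  exact: lower_central_sub (lower_centralR gu Ly).
(* Both xy and yx [x, y] have the same image, and the images commute. *)
apply: (mulIg ([~ cs u, cs x] * [~ cs u, cs y])).
by rewrite mul1g -e.
Qed.

(** Modulo [T] the commutator map is bilinear with values commuting with [L], so
    [[u, v], y] = [u, v'] [u', v'] [u', v] for u' = [u, y] and v' = [v, y]; the
    induction is on the sum of the two heights. *)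
Lemma comm_ucs n k l u v : (k + l <= n)%N -> gam i u -> L v ->
  ucs (gam i.+1) k u -> ucs (gam 1) l v -> ucs T (k + l) [~ u, v].
Proof.
elim: n k l u v => [|n IHn] [|k] [|l] u v // kln gu Lv Uu Uv.
- exact: lower_centralR.
- exact: lower_centralR.
- by apply: (ucs_le nT (leq0n _)); apply: lower_centralR.
- by apply: (ucs_le nT (leq0n _)); apply: comm_derived.
move=> y; set u' := [~ u, y]; set v' := [~ v, y].
have gu' : gam i u' by apply: normalRl => //; apply: lower_central_normal.
have Lv' : L v' by apply: normalRl.
have kl2 : (k + l.+1 <= n)%N by rewrite -ltnS -addSn.
have Uy1 : ucs T (k + l.+1) [~ u', v] by apply: IHn => //; apply: Uu.
have Uy2 : ucs T (k + l.+1) [~ u, v'].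
  by rewrite addnS -addSn; apply: IHn => //; [rewrite addSn -addnS | apply: Uv].
have Uy3 : ucs T (k + l.+1) [~ u', v'].
  apply: (ucs_le nT (_ : k + l <= _)%N); first by rewrite addnS.
  by apply: IHn => //; [rewrite addnS in kl2; apply: ltnW | apply: Uu | apply: Uv].
have nU := ucs_normal (k + l.+1) nT.
pose p := [~ u, v'] * [~ u', v'] * [~ u', v].
have Up : ucs T (k + l.+1) p by do 2!apply: (subgroupM nU.1) => //.
have Tp : T (p^-1 * [~ [~ u, v], y]).
  apply/(coset_ofP (nsg nT)).
  have fixJ a b w : gam i a -> L b -> L w -> [~ cs a, cs b] ^ cs w = [~ cs a, cs b].
    move=> ga Lb Lw; rewrite conjgE -coset_ofR.
    by rewrite (lower_central_comm (lower_centralR ga Lb) Lw) mulKg.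
  have Lu' : L u' := lower_central_sub gu'.
  have uyE : cs u ^ cs y = cs u * cs u' by rewrite /u' coset_ofR commgEl mulVKg.
  have vyE : cs v ^ cs y = cs v * cs v' by rewrite /v' coset_ofR commgEl mulVKg.
  have comm2 : commute [~ cs u, cs v'] [~ cs u, cs v].
    rewrite -!coset_ofR; apply: lower_central_comm; first exact: lower_centralR.
    exact: lower_central_sub (lower_centralR gu Lv).
  (* From here on u' and v' are only known through uyE and vyE; as commutators they
     would be unfolded by the rewriting. *)
  move: u' v' gu' Lv' Uy1 Uy2 Uy3 @p Up Lu' uyE vyE comm2 => u' v' gu' Lv' _ _ _ p _ Lu' uyE vyE comm2.
  rewrite /p (coset_ofM _ ([~ u, v'] * [~ u', v'])) (coset_ofM _ [~ u, v']) !coset_ofR.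
  rewrite [RHS]commgEl conjRg uyE vyE commMg_conj !commgM_conj conjMg !fixJ //.
  have cancel (b c d e : quotient_group (nsg nT)) :
      commute b c -> b * d * e = c^-1 * (b * c * (d * e)).
    by move=> bc; rewrite bc !mulgA mulVg mul1g.
  exact: cancel comm2.
rewrite -(mulVKg p [~ [~ u, v], y]); apply: (subgroupM nU.1) => //.
exact: (ucs_le nT (leq0n _)).
Qed.

End Bilinear.

(** P. Hall's argument: each factor of the lower central series of [L] is spanned
    by values of a bilinear map on the previous factor and [L / L']. *)
Theorem lower_central_ucs :
  (forall x, L x -> exists k, ucs (gam 1) k x) ->
  forall i x, gam i x -> exists k, ucs (gam i.+1) k x.
Proof.
move=> loc; elim=> [|i IHi]; first exact: loc.
have nT := lower_central_normal i.+2.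
have nU k := ucs_normal k nT.
apply: generated_sub; last first.
  move=> _ [u gu [v Lv <-]]; have [k Uu] := IHi u gu; have [l Uv] := loc v Lv.
  by exists (k + l)%N; apply: (comm_ucs (leqnn _)).
split=> [|x y [k Ux] [l Uy]|x [k Ux]].
- by exists 0%N; apply: subgroup1 nT.1.
- exists (k + l)%N; apply: (subgroupM (nU _).1).
    exact: (ucs_le nT (leq_addr l k)).
  exact: (ucs_le nT (leq_addl k l)).
- by exists k; apply: (subgroupV (nU _).1).
Qed.

End Hall.

(** * The transfinite upper central series *)

Section Hypercentre.
Variable G : groupType.
Implicit Types (x y z N : set G) (F : set (set G)).

(** The part [[set 1]] makes the limit of the empty family the trivial subgroup. *)
Definition limit_of F : set G := [set 1] `|` \bigcup_(N in F) N.

(** The terms of the transfinite upper central series, without ordinals: the least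
    family closed under successors and under unions of chains.  It is well-ordered
    by inclusion, as in Zermelo's construction, and so it indexes itself. *)
Inductive uc_term : set G -> Prop :=
| uc_succ N : uc_term N -> uc_term (ucs N 1)
| uc_limit F : total_on F subset -> (forall N, F N -> uc_term N) ->
    uc_term (limit_of F).

Lemma limit_of_sub F z : z 1 -> (forall N, F N -> N `<=` z) -> limit_of F `<=` z.
Proof. by move=> z1 Fz g [->|[N FN Ng]] //; apply: Fz FN _ Ng. Qed.

Lemma sub_limit_of F N : F N -> N `<=` limit_of F.
Proof. by move=> FN g Ng; right; exists N. Qed.

Lemma uc_term_normal N : uc_term N -> is_normal N.
Proof.
elim=> {N} [N _ nN|F totF _ nF]; first exact: ucs_normal.
have [[N FN]|F0] := pselect (F !=set0); last first.
  suff -> : limit_of F = [set 1] by apply: is_normal1.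
  apply/seteqP; split; last by move=> g ->; left.
  by apply: limit_of_sub => // N FN; case: F0; exists N.
suff -> : limit_of F = \bigcup_(N in F) N by apply: normal_bigcup => //; exists N.
apply/seteqP; split; last by move=> g; right.
move=> g [->|//]; exists N => //; exact: subgroup1 (nF N FN).1.
Qed.

Lemma uc_term1 N : uc_term N -> N 1.
Proof. by move/uc_term_normal => [sN _]; apply: subgroup1. Qed.

Lemma uc_term_le N : uc_term N -> N `<=` ucs N 1.
Proof. by move/uc_term_normal; apply: (@ucsS _ N 0). Qed.

Definition comparable_below x : Prop :=
  forall y, uc_term y -> y `<=` x -> y = x \/ ucs y 1 `<=` x.

(** Zermelo's dichotomy, by induction on the construction of [y]. *)
Lemma comparable_cut x y : uc_term x -> comparable_below x -> uc_term y ->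
  y `<=` x \/ ucs x 1 `<=` y.
Proof.
move=> hx cx; elim=> {y} [y hy [yx|xy]|F totF hF IHF].
- case: (cx y hy yx) => [->|]; [by right | by left].
- by right; apply: subset_trans xy (uc_term_le hy).
have [[N [FN Nx]]|allN] := pselect (exists N, F N /\ ucs x 1 `<=` N).
  by right; apply: subset_trans Nx (sub_limit_of FN).
left; apply: limit_of_sub; first exact: uc_term1.
by move=> N FN; case: (IHF N FN) => // Nx; case: allN; exists N.
Qed.

(** Induction on the construction of [x], with [comparable_cut] for the earlier
    terms. *)
Lemma comparable_belowP x : uc_term x -> comparable_below x.
Proof.
elim=> {x} [x hx cx|F totF hF cF] y hy yx.
  case: (comparable_cut hx cx hy) => [yx'|xy]; last by left; apply/seteqP.
  right; case: (cx y hy yx') => [->//|yx'']; exact: subset_trans yx'' (uc_term_le hx).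
have [[N [FN Ny]]|allN] := pselect (exists N, F N /\ ~ (N `<=` y)); last first.
  left; apply/seteqP; split=> //; apply: limit_of_sub; first exact: uc_term1.
  by move=> N FN; apply: contrapT => Ny; apply: allN; exists N.
have hN := hF N FN; right; apply: subset_trans (sub_limit_of FN).
case: (comparable_cut hN (cF N FN) hy) => [yN|Ny'].
  by case: (cF N FN y hy yN) => // yN'; case: Ny; rewrite yN'.
by case: Ny; apply: subset_trans (uc_term_le hN) Ny'.
Qed.

Lemma uc_term_cut x y : uc_term x -> uc_term y ->
  y `<=` x \/ ucs x 1 `<=` y.
Proof. by move=> hx; apply: comparable_cut => //; apply: comparable_belowP. Qed.

Lemma uc_term_total x y : uc_term x -> uc_term y -> x `<=` y \/ y `<=` x.
Proof.
move=> hx hy; case: (uc_term_cut hx hy); [by right|left].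
by apply: subset_trans (uc_term_le hx) _.
Qed.

(** The order on the terms is carried by this type; equality of indices is
    equality of sets by proof irrelevance. *)
Record uc_index := UcIndex { uc_val :> set G; uc_valP : uc_term uc_val }.

Lemma uc_index_inj (a b : uc_index) : uc_val a = uc_val b -> a = b.
Proof. by case: a b => [x hx] [y hy] /= e; subst; rewrite (Prop_irrelevance hx hy). Qed.

HB.instance Definition _ := gen_eqMixin uc_index.
HB.instance Definition _ := gen_choiceMixin uc_index.

Definition uc_le (a b : uc_index) : bool := `[< uc_val a `<=` uc_val b >].

Fact uc_le_refl : reflexive uc_le. Proof. by move=> a; apply/asboolP. Qed.
Fact uc_le_anti : antisymmetric uc_le.
Proof.
by move=> a b /andP[/asboolP ab /asboolP ba]; apply: uc_index_inj; apply/seteqP.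
Qed.
Fact uc_le_trans : transitive uc_le.
Proof.
move=> b a c /asboolP ab /asboolP bc; apply/asboolP; exact: subset_trans bc.
Qed.
Fact uc_le_total : total uc_le.
Proof.
move=> a b; case: (uc_term_total (uc_valP a) (uc_valP b)) => /asboolP ab.
  by apply/orP; left.
by apply/orP; right.
Qed.

Fact uc_display : Order.disp_t. Proof. exact: Order.Disp tt tt. Qed.

HB.instance Definition _ := Order.Le_isPOrder.Build uc_display uc_index
  uc_le_refl uc_le_anti uc_le_trans.
HB.instance Definition _ := Order.POrder_isTotal.Build uc_display uc_index uc_le_total.

Fact uc_bot : uc_term (limit_of set0).
Proof. by apply: uc_limit. Qed.
Fact uc_top : uc_term (limit_of uc_term).
Proof. by apply: uc_limit => // x y; apply: uc_term_total. Qed.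

Lemma uc_leE (a b : uc_index) : (a <= b)%O = `[< uc_val a `<=` uc_val b >].
Proof. by []. Qed.

Fact uc_bot_le (a : uc_index) : (UcIndex uc_bot <= a)%O.
Proof.
rewrite uc_leE; apply/asboolP; apply: limit_of_sub => [|N []//].
exact: (uc_term1 (uc_valP a)).
Qed.
Fact uc_le_top (a : uc_index) : (a <= UcIndex uc_top)%O.
Proof. by rewrite uc_leE; apply/asboolP; apply: sub_limit_of; apply: uc_valP. Qed.

HB.instance Definition _ := Order.hasBottom.Build uc_display uc_index uc_bot_le.
HB.instance Definition _ := Order.hasTop.Build uc_display uc_index uc_le_top.

Definition uc_nsg (a : uc_index) : normalSubgroup G := nsg (uc_term_normal (uc_valP a)).

(** The largest term: the union of all terms is again a term. *)
Definition hypercentre : set G := limit_of uc_term.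

Lemma uc_ltP (a b : uc_index) : (a < b)%O -> uc_val a `<=` uc_val b /\ ~ uc_val b `<=` uc_val a.
Proof.
move=> ab; split; first by have := ltW ab; rewrite uc_leE => /asboolP.
by move=> ba; move: ab; rewrite ltNge uc_leE => /negP; apply; apply/asboolP.
Qed.

Lemma uc_Acc_le (a b : uc_index) :
  Acc (fun a b : uc_index => (a < b)%O) a -> (b <= a)%O -> Acc (fun a b : uc_index => (a < b)%O) b.
Proof. by move=> [Aa]; rewrite le_eqVlt => /orP[/eqP->|/Aa]. Qed.

(** Accessibility follows the construction: what is properly below a successor is
    below its predecessor, and what is properly below a limit is below one of
    its members. *)
Lemma uc_wf : well_founded (fun a b : uc_index => (a < b)%O).
Proof.
suff main x : uc_term x -> forall hx : uc_term x,
    Acc (fun a b : uc_index => (a < b)%O) (UcIndex hx) by move=> [x hx]; apply: main.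
elim=> {x} [x hx' IHx|F totF hF IHF] hx.
  constructor=> b /uc_ltP[bx xb]; apply: (uc_Acc_le (IHx hx')).
  rewrite uc_leE; apply/asboolP; rewrite /=.
  by case: (uc_term_cut hx' (uc_valP b)) => // /xb.
constructor=> b /uc_ltP[bF Fb].
have [N [FN Nb]] : exists N, F N /\ ~ (N `<=` uc_val b).
  apply: contrapT => noN; apply: Fb; apply: limit_of_sub => [|N FN]; first exact: (uc_term1 (uc_valP b)).
  by apply: contrapT => Nb; apply: noN; exists N.
apply: (uc_Acc_le (IHF N FN (hF N FN))); rewrite uc_leE; apply/asboolP.
by case: (uc_term_total (uc_valP b) (hF N FN)).
Qed.

(** A term fixed by the successor contains all others. *)
Lemma uc_term_stable x y : uc_term x -> ucs x 1 `<=` x -> uc_term y -> y `<=` x.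
Proof.
move=> hx Sx; elim=> {y} [y hy yx|F _ _ IHF]; last by apply: limit_of_sub => //; apply: uc_term1.
by case: (comparable_belowP hx hy yx) => [->|].
Qed.

Lemma uc_succ_index (a b : uc_index) : is_succ a b -> uc_val b = ucs (uc_val a) 1.
Proof.
move=> [ab minb]; have [sab nba] := uc_ltP ab.
pose s := UcIndex (uc_succ (uc_valP a)).
have asb : uc_val s `<=` uc_val b.
  by case: (uc_term_cut (uc_valP a) (uc_valP b)) => // /nba.
have : (a < s)%O.
  rewrite ltNge uc_leE; apply/negP => /asboolP sa; apply: nba.
  exact: uc_term_stable (uc_valP a) sa (uc_valP b).
by move/minb; rewrite uc_leE => /asboolP bs; apply/seteqP.
Qed.

(** The union of the terms below [b] is itself a term; if it were proper, [b]
    would be its successor. *)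
Lemma uc_limit_index (b : uc_index) : is_limit b ->
  uc_val b = \bigcup_(a in [set a | (a < b)%O]) uc_val a.
Proof.
move=> [b0 nosucc]; set U := \bigcup_(_ in _) _.
pose F := [set uc_val a | a in [set a : uc_index | (a < b)%O]].
have hF : uc_term (limit_of F).
  apply: uc_limit => [_ _ [x _ <-] [y _ <-]|_ [x _ <-]]; last exact: uc_valP.
  exact: uc_term_total (uc_valP x) (uc_valP y).
(* The extra element 1 of the limit already lies in the bottom term, which is
   below b. *)
have UF : limit_of F `<=` U.
  apply: limit_of_sub => [|_ [a ab <-] g ag]; last by exists a.
  exists \bot%O; first by rewrite /= lt_neqAle le0x andbT eq_sym; apply/eqP.
  exact: (uc_term1 (uc_valP _)).
apply/seteqP; split; last by move=> g [a ab ag]; apply: (uc_ltP ab).1.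
apply: subset_trans UF; apply: contrapT => bF.
apply: (nosucc (UcIndex hF)); split.
  by rewrite ltNge uc_leE; apply/negP => /asboolP.
move=> c mc; rewrite leNgt; apply/negP => cb.
by apply: (uc_ltP mc).2 => g cg; apply: sub_limit_of cg; exists c.
Qed.

Lemma ucs1_preim (N : set G) (nN : is_normal N) :
  ucs N 1 = coset_of (nsg nN) @^-1` center (quotient_group (nsg nN)).
Proof.
apply/seteqP; split=> g /= Ng y.
  have [x <-] := coset_of_surj y; apply/commg_eq1; rewrite -coset_ofR.
  by apply/(coset_of_eq1 (nsg nN)); apply: Ng.
apply/(coset_of_eq1 (nsg nN)); rewrite coset_ofR; exact/commg_eq1.
Qed.

Lemma hypercentre_series : upper_central_series uc_nsg.
Proof.
split=> [|a b ab]; last by rewrite -(ucs1_preim (uc_term_normal (uc_valP a))); exact: uc_succ_index.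
split=> [||a b|b].
- exact: uc_wf.
- by apply/seteqP; split=> [g [//|[]//]|g ->]; left.
- by rewrite uc_leE => /asboolP.
- exact: uc_limit_index.
Qed.

Lemma hypercentre_normal : is_normal hypercentre.
Proof. exact: uc_term_normal uc_top. Qed.

Lemma hypercentre_closed : ucs hypercentre 1 `<=` hypercentre.
Proof. by apply: sub_limit_of; apply: uc_succ; apply: uc_top. Qed.

Lemma hypercentre_ucs k : ucs hypercentre k `<=` hypercentre.
Proof.
elim: k => // k IHk g Ug; apply: hypercentre_closed => y; exact/IHk/Ug.
Qed.

Lemma hypercentral_hypercentre : hypercentre = setT -> hypercentral G.
Proof.
by move=> ZT; exists uc_display, uc_index, uc_nsg; split; [exact: hypercentre_series | exact: ZT].
Qed.

End Hypercentre.

(** * Hypercentrality *)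

Theorem theorem1 (G : groupType) (L : normalSubgroup G) :
  nilpotent L ->
  finitely_generated (quotient_group L) ->
  hyper_abelian_or_finite (quotient_group L) ->
  contranormal_free G ->
  hypercentral G.
Proof.
move=> [n Ln] fgQ hypQ cf.
have nL := nsg_normal L.
have [c Lc] : nilpotent_mod L.
  by apply/nilpotent_mod_quotient/fg_hyper_nilpotent => //; apply: contranormal_free_quotient.
have [X gT] : exists X : seq G, generated (L `|` [set` X]) = setT.
  have [A [/finite_seqP[s ->] gA]] := fgQ; exists (map repr s).
  set B := _ `|` _; have sB := generated_subgroup B.
  have LB : L `<=` generated B by move=> x Lx; apply: sub_generated; left.
  rewrite -(preim_im sB LB); apply/seteqP; split=> // g _.
  suff : [set: quotient_group L] `<=` coset_of L @` generated B by apply.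
  rewrite -gA; apply: generated_sub; first exact: subgroup_im.
  move=> u us; exists (repr u); last exact: coset_reprK.
  by apply: sub_generated; right; apply: map_f.
have nG i := lower_central_normal nL i.
have loc x : nsg_set L x -> exists k, ucs (lower_central L 1) k x.
  move=> Lx; pose N := nsg (nG 1%N); pose A := coset_of N @` L.
  have nA : is_normal A := normal_im N nL.
  have gA : generated (A `|` [set` map (coset_of N) X]) = setT by apply: generated_quotient.
  have abA : abelian_set A.
    move=> _ _ [y Ly <-] [z Lz <-]; apply/commg_eq1; rewrite -coset_ofR.
    by apply/(coset_of_eq1 N); apply: lower_centralR.
  have nilA : nilpotent_mod A.
    exists c; apply/seteqP; split=> // u _; have [y <-] := coset_of_surj u.
    apply/ucs_preim; rewrite preim_im ?Lc //; [exact: nL.1 | exact: lower_central_sub].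
  have [|k] := locally_central_abelian (contranormal_free_quotient cf) nA abA gA nilA (a := coset_of N x).
    by exists x.
  by move/ucs_quotient; exists k.
have locG := lower_central_ucs nL loc.
pose Z := @hypercentre G.
have ZU k : ucs Z k `<=` Z by apply: hypercentre_ucs.
have gamZ i : lower_central L (n - i) `<=` Z.
  elim: i => [|i IHi].
    by rewrite subn0 Ln => x ->; apply: subgroup1 (hypercentre_normal G).1.
  case: (ltnP i n) => [ilt|nle]; last first.
    by move: IHi; rewrite (eqP nle) (_ : (n - i.+1)%N = 0%N) //; apply/eqP/leqW.
  move=> x /locG[k]; rewrite subnSK // => /(ucs_mono IHi); exact: ZU.
apply: hypercentral_hypercentre; apply/seteqP; split=> // x _.
apply: (ZU c); apply: (ucs_mono (N := L)); last by rewrite Lc.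
by have := gamZ n; rewrite subnn.
Qed.
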